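(* Consider a system of $M$ agents, where agent $i$ is the linear Gaussian system $$X_i(t+1)=A_iX_i(t)+B_iU_i(t)+N_i(t)$$ with quadratic cost $\mathbb E\sum_{t=0}^{T-1}\big[X_i^{\top}(t)Q_iX_i(t)+U_i^{\top}(t)R_iU_i(t)\big]$, under the conditions given in the context, and suppose the $N$ linear constraints $$\sum_{i=1}^{M}\gamma_{i,n}U_i(t)=0,\qquad 1\le n\le N,\ t=0,1,\dots,T-1,$$ need to be satisfied. Neither the ISO nor the agents know the number $M$ or the dynamics, costs, laws, states or noises of other agents. Consider the following bid-multiple-price iteration. At each time $s=0,1,\dots,T-1$, given the current states $X_i(s)$, start from arbitrary prices $\lambda^0_{n,s}(t)\in\mathbb R$, $1\le n\le N$, $s\le t\le T-1$. At each iterate $k\ge0$, in response to the prices $\{\lambda_{n,s}^k(t)\}$ announced by the ISO, agent $i$ solves the deterministic problem $$\min\ \sum_{t=s}^{T-1}\Big[x_i^{\top}(t)Q_ix_i(t)+u_i(t)^{\top}R_iu_i(t)+\sum_{n=1}^{N}\lambda_{n,s}^k(t)\gamma_{i,n}u_i(t)\Big]$$ subject to $x_i(t+1)=A_ix_i(t)+B_iu_i(t)$, $x_i(s)=X_i(s)$, and communicates its optimal sequence $\{u_{i,s}^k(t):s\le t\le T-1\}$ to the ISO. The ISO then updates $$\lambda_{n,s}^{k+1}(t)=\lambda_{n,s}^k(t)+\alpha^k\Big(\sum_{i=1}^{M}\gamma_{i,n}u_{i,s}^k(t)\Big),\qquad 1\le n\le N,\ s\le t\le T-1,$$ where $\alpha^k>0$,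 $\lim_k\alpha^k=0$ and $\sum_{k=0}^{\infty}\alpha^k=+\infty$. Then the multiple iterations converge, i.e. the limits $\lambda_{n,s}^\star(t)=\lim_k\lambda_{n,s}^k(t)$ and $u_{i,s}^\star(t)=\lim_ku_{i,s}^k(t)$ exist; and if at each time $s$ each agent $i$ applies $U_i(s)=u_{i,s}^\star(s)$, then this bid-multiple-price iteration yields the maximum social welfare under the multiple constraints, i.e. the resulting control process satisfies all the linear constraints and minimizes $\mathbb E\sum_{t=0}^{T-1}\sum_{i=1}^{M}\big[X_i^{\top}(t)Q_iX_i(t)+U_i^{\top}(t)R_iU_i(t)\big]$ over all control processes $U(t)=(U_1(t),\dots,U_M(t))$ that are adapted to $\mathcal F_t$ and satisfy the linear constraints.
   Context: Agent $i$ has a finite-dimensional state $X_i(t)$ and scalar action $U_i(t)$ (electricity consumed from the grid, negative if supplied). $A_i,B_i,Q_i,R_i$ are matrices of compatible dimensions, with $Q_i\ge0$ (positive semidefinite, symmetric) and $R_i>0$; $\gamma_{i,n}$ are given real numbers. Initial conditions are Gaussian, $X_i(0)\sim N(0,\Sigma_{i,0})$, noises are Gaussian, $N_i(t)\sim N(0,P_{i,t})$, and all of these, over all $i$ and $t$, are independent. ($N$ without index denotes the number of linear constraints, while $N_i(t)$ denotes noise.) $\mathcal F_t$ is the $\sigma$-algebra generated by all initial conditions $X_1(0),\dots,X_M(0)$ and all noises $N_i(r)$, $1\le i\le M$, $0\le r\le t-1$. Social welfare is the negative of the sum of the agents' expected costs. *)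

(* Defs.v *)
From HB Require Import structures.
From mathcomp Require Import all_boot all_order all_algebra.
From mathcomp Require Import all_classical all_reals all_analysis.

Set Implicit Arguments.
Unset Strict Implicit.
Unset Printing Implicit Defensive.

Import Order.TTheory GRing.Theory Num.Theory.
Import numFieldNormedType.Exports.

Local Open Scope classical_set_scope.
Local Open Scope ring_scope.

Definition quad {R : realType} {n : nat} (S : 'M[R]_n) (x : 'cV[R]_n) : R :=
  (x^T *m S *m x) 0 0.

Definition psd {R : realType} {n : nat} (S : 'M[R]_n) : Prop :=
  S^T = S /\ forall x : 'cV[R]_n, 0 <= quad S x.

Section Probability.
Context {d : measure_display} {Omega : measurableType d} {R : realType}.
Variable P : probability Omega R.

(* N(0, v) with [v] the variance.  The degenerate case is the Dirac mass at 0;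
   it has to be separated because [normal_prob _ 0] is by convention the uniform
   law on [0, 1], and [normal_prob] expects a standard deviation. *)
Definition centered_normal (v : R) (B : set R) : \bar R :=
  if v == 0 then dirac (0 : R) B else normal_prob 0 (Num.sqrt v) B.

(* Y ~ N(0, S), with S possibly singular: every linear functional a^T Y is
   distributed as N(0, a^T S a). *)
Definition gaussian {n : nat} (Y : Omega -> 'cV[R]_n) (S : 'M[R]_n) : Prop :=
  [/\ psd S,
      (forall j, measurable_fun setT (fun w => Y w j 0)) &
      forall (a : 'cV[R]_n) (B : set R), measurable B ->
        P ((fun w => (a^T *m Y w) 0 0) @^-1` B) = centered_normal (quad S a) B].

Definition coord_events {n : nat} (Y : Omega -> 'cV[R]_n) : set (set Omega) :=
  \bigcup_(j in [set: 'I_n])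
    preimage_set_system setT (fun w => Y w j 0) measurable.

Definition sigma_vector {n : nat} (Y : Omega -> 'cV[R]_n) : set (set Omega) :=
  <<s coord_events Y >>.

Definition mutually_independent {I : finType} (F : I -> set (set Omega)) : Prop :=
  forall (J : {set I}) (E : I -> set Omega),
    (forall k, k \in J -> F k (E k)) ->
    P (\bigcap_(k in [set` J]) E k) = (\prod_(k in J) P (E k))%E.

End Probability.

(* The problem solved by one agent at time [s] from the state [xs], given the
   prices [lam n t].  It refers to the data of that agent only; [g n] is the
   agent's coefficient in the n-th constraint.  Values of [u] and [lam] at times
   before [s] are irrelevant. *)
Section Agent.
Context {R : realType} {dim N T : nat}.
Variables (A : 'M[R]_dim) (B : 'cV[R]_dim) (Q : 'M[R]_dim) (r : R).
Variable g : 'I_N -> R.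
Variables (s : 'I_T) (xs : 'cV[R]_dim) (lam : 'I_N -> 'I_T -> R).

Definition agent_feasible (x : nat -> 'cV[R]_dim) (u : 'I_T -> R) : Prop :=
  x s = xs /\
  forall t : 'I_T, (s <= t)%N -> x t.+1 = A *m x t + u t *: B.

Definition agent_cost (x : nat -> 'cV[R]_dim) (u : 'I_T -> R) : R :=
  \sum_(t < T | (s <= t)%N)
    (quad Q (x t) + u t * r * u t + \sum_(n < N) lam n t * g n * u t).

Definition agent_optimal (u : 'I_T -> R) : Prop :=
  exists2 x, agent_feasible x u &
    forall x' u', agent_feasible x' u' -> agent_cost x u <= agent_cost x' u'.

End Agent.

Section System.
Context {R : realType} {M N T : nat} {dim : 'I_M -> nat}.

(* Iteration index first: [lam k n t] and [u k i t] are the prices and the bids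
   of the k-th round of the iteration carried out at time [s]. *)
Definition price_iteration
    (A : forall i, 'M[R]_(dim i)) (B : forall i, 'cV[R]_(dim i))
    (Q : forall i, 'M[R]_(dim i)) (r : 'I_M -> R) (gam : 'I_M -> 'I_N -> R)
    (alpha : nat -> R) (s : 'I_T) (xs : forall i, 'cV[R]_(dim i))
    (lam : nat -> 'I_N -> 'I_T -> R) (u : nat -> 'I_M -> 'I_T -> R) : Prop :=
  forall k : nat,
    (forall i, agent_optimal (A i) (B i) (Q i) (r i) (gam i) s (xs i)
                 (lam k) (u k i)) /\
    (forall n (t : 'I_T), (s <= t)%N ->
       lam k.+1 n t = lam k n t + alpha k * \sum_(i < M) gam i n * u k i t).

Context {d : measure_display} {Omega : measurableType d}.

Definition state_process
    (A : forall i, 'M[R]_(dim i)) (B : forall i, 'cV[R]_(dim i))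
    (X0 : forall i, Omega -> 'cV[R]_(dim i))
    (W : forall i, 'I_T -> Omega -> 'cV[R]_(dim i))
    (U : 'I_M -> 'I_T -> Omega -> R)
    (X : forall i, nat -> Omega -> 'cV[R]_(dim i)) : Prop :=
  forall i w, X i 0%N w = X0 i w /\
    forall t : 'I_T, X i t.+1 w = A i *m X i t w + U i t w *: B i + W i t w.

Definition social_cost (P : probability Omega R)
    (Q : forall i, 'M[R]_(dim i)) (r : 'I_M -> R)
    (X : forall i, nat -> Omega -> 'cV[R]_(dim i))
    (U : 'I_M -> 'I_T -> Omega -> R) : \bar R :=
  'E_P[fun w => \sum_(t < T) \sum_(i < M)
         (quad (Q i) (X i t w) + U i t w * r i * U i t w)].

Definition primitive (X0 : forall i, Omega -> 'cV[R]_(dim i))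
    (W : forall i, 'I_T -> Omega -> 'cV[R]_(dim i))
    (k : 'I_M * option 'I_T) : Omega -> 'cV[R]_(dim k.1) :=
  if k.2 is Some t then W k.1 t else X0 k.1.

Definition filtration (X0 : forall i, Omega -> 'cV[R]_(dim i))
    (W : forall i, 'I_T -> Omega -> 'cV[R]_(dim i)) (t : 'I_T) :
    set (set Omega) :=
  <<s (\bigcup_(i in [set: 'I_M]) coord_events (X0 i)) `|`
      (\bigcup_(p in [set p : 'I_M * 'I_T | (p.2 < t)%N])
         coord_events (W p.1 p.2)) >>.

Definition adapted (F : 'I_T -> set (set Omega))
    (U : 'I_M -> 'I_T -> Omega -> R) : Prop :=
  forall i t (C : set R), measurable C -> F t (U i t @^-1` C).

Definition constraints (gam : 'I_M -> 'I_N -> R)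
    (U : 'I_M -> 'I_T -> Omega -> R) : Prop :=
  forall n t w, \sum_(i < M) gam i n * U i t w = 0.

End System.

(* Main.v *)
(* From any state, the ISO's prices follow gradient ascent on the dual of a
   strictly convex quadratic program whose constraints are the balance equations.
   The price error splits into a component that the agents do not see and one in
   the range of the constraints, which is controlled by the error of the bids;
   with vanishing, non-summable steps the latter tends to zero.  The limit bids
   are the unique stationary plan, which is linear in the state.

   For optimality, pair the multiplier of the dynamics along the plan ("costate")
   with the difference of the states under a competing control.  Stationarity and
   the fact that the tail of a plan is a plan make this pairing telescope, path by
   path: the excess cost of the competitor is at least twice a sum of products of
   a linear function of the noise at time t and a linear function of the history
   up to time t.  Such products have mean zero as soon as both factors are
   integrable, so first moments suffice, and a competitor of finite cost has
   integrable controls. *)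
Require Import Defs.
From HB Require Import structures.
From mathcomp Require Import all_boot all_order all_algebra.
From mathcomp Require Import all_classical all_reals all_analysis.
From mathcomp Require Import measurable_realfun ring lra.

Set Implicit Arguments.
Unset Strict Implicit.
Unset Printing Implicit Defensive.

Import Order.TTheory GRing.Theory Num.Theory.
Import numFieldNormedType.Exports.

Local Open Scope classical_set_scope.
Local Open Scope ring_scope.

(** * Dual ascent for strictly convex quadratic programs *)

Section DualAscent.
Context {R : realType}.
Implicit Types (m n p : nat).

Definition dot n (u v : 'rV[R]_n) : R := (u *m v^T) 0 0.

Lemma dotE n (u v : 'rV[R]_n) : dot u v = \sum_j u 0 j * v 0 j.
Proof. by rewrite /dot mxE; apply: eq_bigr => j _; rewrite mxE. Qed.

Lemma dotC n (u v : 'rV[R]_n) : dot u v = dot v u.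
Proof. by rewrite !dotE; apply: eq_bigr => j _; rewrite mulrC. Qed.

Lemma dotDl n (u v w : 'rV[R]_n) : dot (u + v) w = dot u w + dot v w.
Proof. by rewrite /dot mulmxDl mxE. Qed.

Lemma dotDr n (u v w : 'rV[R]_n) : dot w (u + v) = dot w u + dot w v.
Proof. by rewrite dotC dotDl !(dotC w). Qed.

Lemma dotZl n a (u v : 'rV[R]_n) : dot (a *: u) v = a * dot u v.
Proof. by rewrite /dot -scalemxAl mxE. Qed.

Lemma dotZr n a (u v : 'rV[R]_n) : dot u (a *: v) = a * dot u v.
Proof. by rewrite dotC dotZl dotC. Qed.

Lemma dot0l n (u : 'rV[R]_n) : dot 0 u = 0.
Proof. by rewrite -(scale0r 0) dotZl mul0r. Qed.

Lemma dot_sqrDZ n a (u v : 'rV[R]_n) :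
  dot (u + a *: v) (u + a *: v) = dot u u + 2 * a * dot u v + a * (a * dot v v).
Proof. by rewrite dotDl !dotDr !dotZl !dotZr (dotC v); lra. Qed.

Lemma dot_mulmxl m n (u : 'rV[R]_m) (v : 'rV[R]_n) (G : 'M[R]_(m, n)) :
  dot (u *m G) v = dot u (v *m G^T).
Proof. by rewrite /dot trmx_mul trmxK mulmxA. Qed.

Lemma dot_ge0 n (u : 'rV[R]_n) : 0 <= dot u u.
Proof. by rewrite dotE; apply: sumr_ge0 => j _; rewrite -expr2 sqr_ge0. Qed.

Lemma dot_coord n (u : 'rV[R]_n) j : u 0 j ^+ 2 <= dot u u.
Proof.
rewrite dotE (bigD1 j)//= -expr2 lerDl.
by apply: sumr_ge0 => i _; rewrite -expr2 sqr_ge0.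
Qed.

Lemma dot_eq0 n (u : 'rV[R]_n) : dot u u = 0 -> u = 0.
Proof.
move=> u0; apply/rowP => j; rewrite [RHS]mxE; apply/eqP.
by rewrite -sqrf_eq0 eq_le sqr_ge0 andbT -u0 dot_coord.
Qed.

Lemma dot_mulmx_bound m n (G : 'M[R]_(m, n)) :
  exists2 C, 0 < C & forall u, dot (u *m G) (u *m G) <= C * dot u u.
Proof.
(* The summand 1 only makes the constant positive; the rest comes from bounding each [|u 0 i|] by
   the norm of [u]. *)
exists (1 + \sum_(j < n) \sum_i `|G i j| * \sum_k `|G k j|).
  rewrite ltr_pwDl// sumr_ge0// => j _; rewrite sumr_ge0// => i _.
  by rewrite mulr_ge0// sumr_ge0.
move=> u; rewrite [X in X <= _]dotE mulrDl mul1r.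
rewrite -[X in X <= _]add0r lerD ?dot_ge0//.
rewrite mulr_suml ler_sum// => j _; rewrite -expr2.
rewrite -real_normK ?num_real// expr2.
have uj i : `|u 0 i| <= Num.sqrt (dot u u).
  by rewrite -sqrtr_sqr ler_sqrt ?dot_coord ?dot_ge0.
have B : `|(u *m G) 0 j| <= (\sum_i `|G i j|) * Num.sqrt (dot u u).
  rewrite mxE (le_trans (ler_norm_sum _ _ _))// mulr_suml ler_sum// => i _.
  by rewrite normrM mulrC ler_wpM2l.
rewrite (le_trans (ler_pM _ _ B B))// mulrACA -expr2 -expr2 sqr_sqrtr ?dot_ge0//.
by rewrite expr2 [X in X * dot u u <= _]mulr_suml.
Qed.

Definition coercive n (H : 'M[R]_n) (h : R) :=
  forall d : 'rV_n, h * dot d d <= dot (d *m H) d.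

Lemma coercive_unit n (H : 'M[R]_n) h : 0 < h -> coercive H h -> H \in unitmx.
Proof.
move=> h0 hH; rewrite -row_free_unit -kermx_eq0; apply/rowV0P => v /sub_kermxP vH.
apply: dot_eq0; apply/eqP; rewrite eq_le dot_ge0 andbT.
by have := hH v; rewrite vH dot0l pmulr_rle0.
Qed.


(** Right multiplication by [B] is injective on the row space of [A], so [A *m B] keeps the rank of
    [A]; an inclusion of row spaces with enough rank is an equality. *)
Lemma submx_mulmx_ker m n p q (A : 'M[R]_(m, n)) (B : 'M[R]_(n, p))
    (C : 'M[R]_(q, p)) :
  (forall z : 'rV_m, z *m A *m B = 0 -> z *m A = 0) ->
  (A *m B <= C)%MS -> (\rank C <= \rank A)%N -> (C <= A *m B)%MS.
Proof.
move=> ker AB_C rCA; rewrite -(geq_leqif (mxrank_leqif_sup AB_C)).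
rewrite (leq_trans rCA)//; have /mxrank_injP -> // : (A :&: kermx B)%MS == 0.
apply/rowV0P => v; rewrite sub_capmx => /andP[/submxP[z ->]] /sub_kermxP.
exact: ker.
Qed.

(** If [z G G^T = 0] then [z G] has norm zero. The factor provided by this inclusion inverts [G^T]
    on the row space of [G]. *)
Lemma gram_mx_submx m n (G : 'M[R]_(n, m)) : (G^T <= G *m G^T)%MS.
Proof.
apply: submx_mulmx_ker; rewrite ?submxMl ?mxrank_tr// => z zGG.
by apply: dot_eq0; rewrite dot_mulmxl dotC zGG dot0l.
Qed.

(** [G^T H^-1 G] is the matrix of the dual program. If it sends [e = z G] to 0, then
    [d = e G^T H^-1] satisfies [d G = 0], so [dot (d H) d = dot e (d G)] vanishes; coercivity gives
    [d = 0], hence [e G^T = 0] and [e = 0]. *)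
Lemma schur_submx m n (H : 'M[R]_n) (G : 'M[R]_(n, m)) h :
  0 < h -> coercive H h -> (G <= G *m (G^T *m invmx H *m G))%MS.
Proof.
move=> h0 hH; apply: submx_mulmx_ker => //; last by rewrite mulmxA submxMl.
move=> z zGS; set e := z *m G.
pose d := e *m G^T *m invmx H.
have dH : d *m H = e *m G^T.
  by rewrite /d -mulmxA mulVmx ?mulmx1// (coercive_unit h0 hH).
have d0 : d = 0.
  apply: dot_eq0; apply/eqP; rewrite eq_le dot_ge0 andbT.
  have := hH d; rewrite dH dot_mulmxl trmxK.
  have -> : d *m G = 0 by rewrite -[RHS]zGS /d !mulmxA.
  by rewrite [X in _ <= X]dotC dot0l pmulr_rle0.
apply: dot_eq0; have -> : dot e e = dot z (e *m G^T) by rewrite -dot_mulmxl.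
by rewrite -dH d0 mul0mx dotC dot0l.
Qed.

(** From [k0] on, [E] is nonincreasing. If it stayed above some [e > 0], the total decrease would be
    at least [c e] times a divergent sum, contradicting [0 <= E]. *)
Lemma vanishing_of_decay (E al : nat -> R) (c : R) (k0 : nat) :
  (forall k, 0 <= E k) -> (forall k, 0 < al k) -> 0 < c ->
  series al n @[n --> \oo] --> +oo ->
  (forall k, (k0 <= k)%N -> E k.+1 <= E k - c * al k * E k) ->
  E k @[k --> \oo] --> 0.
Proof.
move=> E0 al0 c0 al_sum dec.
have mono k j : (k0 <= k)%N -> E (k + j)%N <= E k.
  move=> k0k; elim: j => [|j IH]; first by rewrite addn0.
  rewrite addnS (le_trans (dec _ _)) ?(leq_trans k0k) ?leq_addr//.
  by rewrite (le_trans _ IH)// gerBl !mulr_ge0// ltW.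
apply/cvgrPdist_lt => e e0.
have [k k0k Ek] : exists2 k, (k0 <= k)%N & E k < e.
  apply: contrapT => nE.
  have Ege k : (k0 <= k)%N -> e <= E k.
    by move=> k0k; rewrite leNgt; apply/negP => Ek; apply: nE; exists k.
  have ub j : c * e * (series al (k0 + j)%N - series al k0) <= E k0 - E (k0 + j)%N.
    elim: j => [|j IH]; first by rewrite addn0 !subrr mulr0.
    rewrite addnS seriesSr.
    have := dec (k0 + j)%N (leq_addr _ _).
    have : c * al (k0 + j)%N * e <= c * al (k0 + j)%N * E (k0 + j)%N.
      by rewrite ler_wpM2l ?mulr_ge0 ?(ltW c0) ?(ltW (al0 _)) ?Ege ?leq_addr.
    move: IH; set a := al _; set s := series al _; set s0 := series al _.
    by move: (E k0) (E (k0 + j)%N) (E (k0 + j).+1) => x y z; lra.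
  have /cvgryPgt/(_ (series al k0 + E k0 / (c * e))) := al_sum.
  move=> [K _ /(_ (k0 + K)%N (leq_addl _ _))]/=.
  rewrite addrC -ltrBrDr ltr_pdivrMr ?mulr_gt0// => lt1.
  have := lt_le_trans lt1 _; rewrite mulrC => /(_ _ (ub K)).
  by rewrite ltNge gerBl E0.
exists k => // l /= kl; rewrite sub0r normrN ger0_norm//.
by rewrite -(subnKC kl) (le_lt_trans (mono _ _ k0k)).
Qed.

Lemma cvg_sqr0 (f : nat -> R) : f k ^+ 2 @[k --> \oo] --> 0 -> f k @[k --> \oo] --> 0.
Proof.
move=> f2; apply: norm_cvg0; under eq_fun do rewrite -sqrtr_sqr.
by rewrite -(@sqrtr0 R); apply: continuous_cvg f2; exact: sqrt_continuous.
Qed.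

(** The constrained solution is linear in [b]: the multiplier [b H^-1 L G] cancels the imbalance of
    the unconstrained solution [b H^-1]. *)
Lemma kkt_matrix m n (H : 'M[R]_n) (G : 'M[R]_(n, m)) h :
  0 < h -> coercive H h ->
  exists K : 'M[R]_n, forall b : 'rV_n, b *m K *m G = 0 /\
    exists lam : 'rV_m, b *m K *m H = b - lam *m G^T.
Proof.
move=> h0 hH; have uH := coercive_unit h0 hH.
have /submxP[L GL] := schur_submx G h0 hH.
exists ((1%:M - invmx H *m L *m G *m G^T) *m invmx H) => b; split.
  rewrite !mulmxA mulmxBr mulmx1 !mulmxBl !mulmxA.
  by rewrite {1}GL !mulmxA subrr.
exists (b *m (invmx H *m L *m G)).
by rewrite mulmxA mulmxKV// mulmxBr mulmx1 !mulmxA.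
Qed.

(* The error [e] of the multipliers stays in the row space of [G], on which the
   primal error [d = - e G^T H^-1] controls it, so that its square norm decreases
   by a factor [1 - c al k] as soon as [al k] is small. *)
Lemma dual_ascent m n (H : 'M[R]_n) (G : 'M[R]_(n, m)) (h : R) (b : 'rV[R]_n)
    (al : nat -> R) (lam : nat -> 'rV[R]_m) (u : nat -> 'rV[R]_n) :
  0 < h -> coercive H h ->
  (forall k, 0 < al k) -> al k @[k --> \oo] --> 0 ->
  series al n @[n --> \oo] --> +oo ->
  (forall k, u k *m H = b - lam k *m G^T) ->
  (forall k, lam k.+1 = lam k + al k *: (u k *m G)) ->
  exists (lams : 'rV[R]_m) (us : 'rV[R]_n),
    [/\ us *m G = 0, us *m H = b - lams *m G^T,
        forall j, lam k 0 j @[k --> \oo] --> lams 0 j &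
        forall j, u k 0 j @[k --> \oo] --> us 0 j].
Proof.
move=> h0 hH al0 al_0 al_sum uk lamS; have uH := coercive_unit h0 hH.
have /submxP[L GL] := schur_submx G h0 hH.
have /submxP[L' GL'] := gram_mx_submx G.
(* [c0] is the response to the initial prices, and [GL] converts its imbalance into the correction
   [z0 *m G]. The limit price thus depends on the initial one, from which it differs by an element
   of the row space of [G]. *)
pose c0 := (b - lam 0%N *m G^T) *m invmx H.
pose z0 := c0 *m L; pose lams := lam 0%N + z0 *m G.
pose us := (b - lams *m G^T) *m invmx H.
have usG : us *m G = 0.
  rewrite /us /lams (mulmxDl (lam 0%N)) opprD addrA mulmxBl mulmxBl -/c0 {1}GL /z0.
  by rewrite !mulmxA subrr.
have usH : us *m H = b - lams *m G^T by rewrite mulmxKV.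
pose e k := lam k - lams; pose d k := u k - us.
have dH k : d k *m H = - (e k *m G^T).
  by rewrite mulmxBl uk usH /e mulmxBl; apply/rowP => j; rewrite !mxE; lra.
have eS k : e k.+1 = e k + al k *: (d k *m G).
  by rewrite /e lamS /d mulmxBl usG subr0 addrAC.
have eG k : exists z, e k = z *m G.
  elim: k => [|k [z zE]].
    by exists (- z0); rewrite /e /lams mulNmx opprD addrA subrr sub0r.
  by exists (z + al k *: d k); rewrite eS zE mulmxDl scalemxAl.
have [C1 C10 dG_le] := dot_mulmx_bound G.
have [C2 C20 dHL_le] := dot_mulmx_bound (H *m L'^T).
(* [GL'] recovers [e k] from [e k *m G^T = - (d k *m H)], so the primal error bounds the multiplier
   error. *)
have e_le k : dot (e k) (e k) <= C2 * dot (d k) (d k).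
  have [z zE] := eG k.
  have -> : e k = - (d k *m (H *m L'^T)).
    have GE : G = G *m G^T *m L'^T.
      by have := congr1 trmx GL'; rewrite !trmx_mul !trmxK.
    by rewrite mulmxA dH mulNmx opprK zE {1}GE !mulmxA.
  by rewrite -(scaleN1r (_ *m _)) dotZl dotZr mulrA mulrNN !mul1r.
have ed k : dot (e k) (d k *m G) = - dot (d k *m H) (d k).
  by rewrite dotC dot_mulmxl dH -(scaleN1r (_ *m _)) dotZl mulN1r opprK dotC.
(* Below [h / C1] the second-order term of the step is absorbed by half of the first-order decrease
   [2 * al k * dot (d k *m H) (d k)]. *)
have [k0 _ small] : \forall k \near \oo, al k < h / C1.
  have /cvgrPdist_lt/(_ (h / C1)) := al_0; rewrite divr_gt0// => /(_ isT).
  by apply: filterS => k; rewrite sub0r normrN gtr0_norm.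
have E0 : dot (e k) (e k) @[k --> \oo] --> 0.
  apply: (@vanishing_of_decay _ al (h / C2) k0) => //.
  - by move=> k; apply: dot_ge0.
  - by rewrite divr_gt0.
  move=> k /small; rewrite ltr_pdivlMr// => alC1.
  rewrite eS dot_sqrDZ ed.
  have := hH (d k); have := e_le k; have := dG_le (d k).
  have := dot_ge0 (d k); have := al0 k.
  set E := dot (e k) _; set D := dot (d k) _; set F := dot (_ *m H) _.
  set GG := dot _ _; set a := al k in alC1 *.
  move=> a0 D0 GD ED hF.
  have i1 : a * (a * GG) <= a * (h * D).
    rewrite ler_wpM2l ?(ltW a0)// (le_trans (ler_wpM2l (ltW a0) GD))//.
    by rewrite mulrA ler_wpM2r// ltW.
  have i2 : a * (h * D) <= a * F by rewrite ler_wpM2l ?(ltW a0).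
  have i3 : h / C2 * a * E <= a * (h * D).
    rewrite (_ : a * (h * D) = h / C2 * a * (C2 * D)); last by field; exact: lt0r_neq0.
    by rewrite ler_wpM2l// mulr_ge0 ?(ltW a0)// divr_ge0 ?(ltW h0) ?(ltW C20).
  by lra.
have lamC j : lam k 0 j @[k --> \oo] --> lams 0 j.
  apply/subr_cvg0; apply: cvg_sqr0.
  apply: (@squeeze_cvgr _ _ _ _ (cst 0) (fun k => dot (e k) (e k))) => //;
    last exact: cvg_cst.
  apply: nearW => k; rewrite sqr_ge0/=.
  by have := dot_coord (e k) j; rewrite /e !mxE.
exists lams, us; split => // j.
(* The bids are affine in the prices, so they converge along with them. *)
have uE k : u k 0 j = (b *m invmx H) 0 j - \sum_i lam k 0 i * (G^T *m invmx H) i j.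
  rewrite -[u k](mulmxK uH) uk mulmxBl -mulmxA.
  by rewrite [LHS]mxE; congr (_ + _); rewrite [LHS]mxE; congr (- _); rewrite mxE.
have usE : us 0 j = (b *m invmx H) 0 j - \sum_i lams 0 i * (G^T *m invmx H) i j.
  rewrite /us mulmxBl -mulmxA.
  by rewrite [LHS]mxE; congr (_ + _); rewrite [LHS]mxE; congr (- _); rewrite mxE.
rewrite usE; under eq_fun do rewrite uE.
apply: cvgB; first exact: cvg_cst.
apply: (cvg_big (op := +%R)) => [|i _]; first exact: add_continuous.
by apply: cvgM => //; exact: cvg_cst.
Qed.

End DualAscent.

(** * Plans of the deterministic problem *)

Section LinearForms.
Context {R : realType} {n : nat}.

Lemma linear_form_row (f : 'rV[R]_n -> R) :
  (forall a u v, f (a *: u + v) = a * f u + f v) ->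
  forall v, f v = dot (\row_k f (delta_mx 0 k)) v.
Proof.
move=> lf v.
have f0 : f 0 = 0 by have := lf (-1) 0 0; rewrite scaler0 addr0 mulN1r addNr.
rewrite {1}(row_sum_delta v) dotE.
have fsum (s : seq 'I_n) : f (\sum_(k <- s) v 0 k *: delta_mx 0 k) =
    \sum_(k <- s) (\row_k f (delta_mx 0 k)) 0 k * v 0 k.
  elim: s => [|k s IH]; first by rewrite !big_nil.
  by rewrite !big_cons lf IH mxE mulrC.
exact: fsum.
Qed.

Lemma bilinear_form_mx (f : 'rV[R]_n -> 'rV[R]_n -> R) :
  (forall a u v w, f (a *: u + v) w = a * f u w + f v w) ->
  (forall a u v w, f w (a *: u + v) = a * f w u + f w v) ->
  forall u v, f u v = dot (u *m \matrix_(k, l) f (delta_mx 0 k) (delta_mx 0 l)) v.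
Proof.
move=> fl fr u v; rewrite (linear_form_row (fun a x y => fr a x y u)).
congr dot; apply/rowP => l; rewrite mxE.
rewrite (linear_form_row (fun a x y => fl a x y (delta_mx 0 l)))/=.
by rewrite dotC dotE mxE; apply: eq_bigr => k _; rewrite !mxE.
Qed.

End LinearForms.

Lemma dot_mxvec {R : realType} m n (U V : 'M[R]_(m, n)) :
  dot (mxvec U) (mxvec V) = \sum_i \sum_j U i j * V i j.
Proof.
rewrite dotE (reindex _ (curry_mxvec_bij m n))/= pair_bigA/=.
by apply: eq_bigr => -[i j] _; rewrite /= !mxvecE.
Qed.

Section BilinearMatrixForm.
Context {R : realType} {n : nat}.
Implicit Types (S : 'M[R]_n) (x y z : 'cV[R]_n).

Definition qf S x y : R := (x^T *m S *m y) 0 0.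

Lemma quad_qf S x : quad S x = qf S x x. Proof. by []. Qed.

Lemma qfDl S x y z : qf S (x + y) z = qf S x z + qf S y z.
Proof. by rewrite /qf raddfD/= !mulmxDl mxE. Qed.

Lemma qfDr S x y z : qf S z (x + y) = qf S z x + qf S z y.
Proof. by rewrite /qf mulmxDr mxE. Qed.

Lemma qfZl S a x y : qf S (a *: x) y = a * qf S x y.
Proof. by rewrite /qf linearZ/= -!scalemxAl mxE. Qed.

Lemma qfZr S a x y : qf S x (a *: y) = a * qf S x y.
Proof. by rewrite /qf -!scalemxAr mxE. Qed.

Lemma qf0r S x : qf S x 0 = 0.
Proof. by rewrite /qf mulmx0 mxE. Qed.

Lemma qfC S x y : psd S -> qf S x y = qf S y x.
Proof.
move=> [St _]; rewrite /qf.
have -> : x^T *m S *m y = (y^T *m S *m x)^T.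
  by rewrite !trmx_mul trmxK St mulmxA.
by rewrite mxE.
Qed.

Lemma quadD S x y : psd S -> quad S (x + y) = quad S x + 2 * qf S x y + quad S y.
Proof. by move=> hS; rewrite !quad_qf qfDl !qfDr (qfC y x hS); ring. Qed.

Lemma qfE S x y : qf S x y = \sum_k \sum_l x l 0 * S l k * y k 0.
Proof.
rewrite /qf mxE; apply: eq_bigr => k _; rewrite mxE mulr_suml.
by apply: eq_bigr => l _; rewrite mxE.
Qed.

End BilinearMatrixForm.

(** * A single agent: trajectories, stationarity, uniqueness of the bids *)

Section AgentTrajectory.
Context {R : realType} {dim T : nat}.
Variables (A : 'M[R]_dim) (B : 'cV[R]_dim) (Q : 'M[R]_dim) (r : R).
Implicit Types (s t : nat) (x y : 'cV[R]_dim) (u v : 'I_T -> R).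

(** Time is a natural number, so that trajectories can be restarted at [s.+1] even when this is [T].
    The state stays at [x] up to time [s], and the control counts as 0 from [T] on. *)
Fixpoint traj s x u t : 'cV[R]_dim :=
  if t is t'.+1 then
    if (s <= t')%N then A *m traj s x u t' + oapp u 0 (insub t') *: B else x
  else x.

Lemma traj_start s x u : traj s x u s = x.
Proof. by case: s => //= s; rewrite ltnn. Qed.

Lemma trajS s x u (t : 'I_T) : (s <= t)%N ->
  traj s x u t.+1 = A *m traj s x u t + u t *: B.
Proof. by move=> /= ->; rewrite valK. Qed.

Lemma traj_lin s a x y u v t :
  traj s (a *: x + y) (fun j => a * u j + v j) t = a *: traj s x u t + traj s y v t.
Proof.
elim: t => //= t IH; case: ifP => // _; rewrite IH mulmxDr -scalemxAr scalerDr.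
rewrite scalerA addrACA -scalerDl; congr (_ + _ *: _).
by case: insub => [j|]//=; rewrite mulr0 addr0.
Qed.

Lemma eq_traj s x u v t : (forall j : 'I_T, (s <= j)%N -> u j = v j) ->
  traj s x u t = traj s x v t.
Proof.
move=> uv; elim: t => //= t IH; case: ifP => // st; rewrite IH.
by case: insubP => //= j _ jt; rewrite uv// jt.
Qed.

Lemma traj_restart s s' x u t : (s <= s')%N -> (s' <= t)%N ->
  traj s x u t = traj s' (traj s x u s') u t.
Proof.
move=> ss'; elim: t => [|t IH]; first by rewrite leqn0 => /eqP ->.
rewrite leq_eqVlt => /predU1P[<-|]; first by rewrite traj_start.
by rewrite ltnS => s't /=; rewrite s't (leq_trans ss' s't) IH.
Qed.

Lemma traj0 s t : traj s 0 (fun=> 0) t = 0.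
Proof.
have := traj_lin s (-1) 0 0 (fun=> 0) (fun=> 0) t.
rewrite scaler0 addr0 scaleN1r addNr => E; rewrite -[RHS]E.
by apply: eq_traj => j _; rewrite mulr0 addr0.
Qed.

Lemma agent_feasible_traj (s : 'I_T) x xx u :
  agent_feasible A B s x xx u ->
  forall t, (s <= t <= T)%N -> xx t = traj s x u t.
Proof.
move=> [xs xS]; elim => [|t IH].
  by case/andP; rewrite leqn0 => /eqP s0 _; rewrite -xs s0.
move=> /andP[]; rewrite leq_eqVlt => /predU1P[<-|].
  by rewrite traj_start.
rewrite ltnS => st tT; rewrite (xS (Ordinal tT))// (trajS x u (t := Ordinal tT))//=.
by rewrite -IH// st ltnW.
Qed.

Lemma traj_feasible (s : 'I_T) x u : agent_feasible A B s x (traj s x u) u.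
Proof. by split => [|t st]; [exact: traj_start|exact: trajS]. Qed.

(* Half the derivative at [u], in the direction [v], of the cost from time [s]. *)
Definition slope s x u v : R :=
  \sum_(t < T | (s <= t)%N)
    (qf Q (traj s x u t) (traj s 0 v t) + u t * r * v t).

Lemma slope_linl s a x y u u' v :
  slope s (a *: x + y) (fun j => a * u j + u' j) v =
  a * slope s x u v + slope s y u' v.
Proof.
rewrite /slope mulr_sumr -big_split; apply: eq_bigr => t _ /=.
by rewrite traj_lin qfDl qfZl; ring.
Qed.

Lemma slope_linr s a x u v v' :
  slope s x u (fun j => a * v j + v' j) = a * slope s x u v + slope s x u v'.
Proof.
rewrite /slope mulr_sumr -big_split; apply: eq_bigr => t _ /=.
rewrite (_ : 0 = a *: 0 + 0 :> 'cV_dim); last by rewrite scaler0 addr0.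
by rewrite traj_lin scaler0 addr0 qfDr qfZr; ring.
Qed.

Lemma eq_slope s x u u' v v' :
  (forall j : 'I_T, (s <= j)%N -> u j = u' j) ->
  (forall j : 'I_T, (s <= j)%N -> v j = v' j) -> slope s x u v = slope s x u' v'.
Proof.
move=> uu vv; apply: eq_bigr => t st.
by rewrite (eq_traj _ _ uu) (eq_traj _ _ vv) uu// vv.
Qed.

Hypotheses (hQ : psd Q) (hr : 0 < r).

(** The state terms are nonnegative, so the control terms alone give strict convexity; all
    uniqueness and coercivity below come from here. *)
Lemma slope_ge s u : \sum_(t < T | (s <= t)%N) r * u t ^+ 2 <= slope s 0 u u.
Proof.
apply: ler_sum => t _; have [_ Qge0] := hQ.
have := Qge0 (traj s 0 u t); rewrite quad_qf expr2.
by rewrite (_ : u t * r * u t = r * (u t * u t)) ?lerDr//; ring.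
Qed.

Lemma slope_ge0 s u : 0 <= slope s 0 u u.
Proof.
apply: le_trans (slope_ge s u); apply: sumr_ge0 => t _.
by rewrite mulr_ge0 ?sqr_ge0// ltW.
Qed.

Lemma slope_eq0 s u : slope s 0 u u <= 0 ->
  forall t : 'I_T, (s <= t)%N -> u t = 0.
Proof.
move=> /(le_trans (slope_ge s u)) u0 t st; apply/eqP; rewrite -sqrf_eq0.
rewrite eq_le sqr_ge0 andbT -(pmulr_rle0 _ hr) (le_trans _ u0)//.
rewrite (bigD1 t)//= lerDl; apply: sumr_ge0 => j _.
by rewrite mulr_ge0 ?sqr_ge0// ltW.
Qed.

Section Prices.
Context {N : nat}.
Variables (g : 'I_N -> R) (s : 'I_T) (x : 'cV[R]_dim) (lam : 'I_N -> 'I_T -> R).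

Definition price v : R :=
  \sum_(t < T | (s <= t)%N) \sum_n lam n t * g n * v t.

Let cost u : R := agent_cost Q r g s lam (traj s x u) u.

(** Along a line the cost is a quadratic polynomial in [a], with nonnegative leading coefficient. *)
Let costD a u v : cost (fun j => a * v j + u j) =
  cost u + a * (2 * slope s x u v + price v) + a ^+ 2 * slope s 0 v v.
Proof.
rewrite mulrDr mulrA addrA /cost /agent_cost /slope /price.
rewrite !mulr_sumr -!big_split; apply: eq_bigr => t st /=.
rewrite {1}(_ : x = a *: 0 + x); last by rewrite scaler0 add0r.
rewrite traj_lin !quad_qf qfDl !qfDr !qfZl !qfZr (qfC (traj s 0 v t) (traj s x u t) hQ).
rewrite (_ : \sum_n lam n t * g n * (a * v t + u t) =
  a * \sum_n lam n t * g n * v t + \sum_n lam n t * g n * u t); first by ring.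
by rewrite mulr_sumr -big_split; apply: eq_bigr => n _ /=; ring.
Qed.

Lemma agent_optimalP u : agent_optimal A B Q r g s x lam u <->
  forall v, 2 * slope s x u v + price v = 0.
Proof.
have costE xx w : agent_feasible A B s x xx w -> agent_cost Q r g s lam xx w = cost w.
  move=> /agent_feasible_traj xxE; apply: eq_bigr => t st.
  by rewrite xxE// st ltnW.
split=> [[xx fxx opt] v|st].
  set l := 2 * _ + _; set q := slope s 0 v v.
  have q0 : 0 <= q by apply: slope_ge0.
  have H a : 0 <= a * l + a ^+ 2 * q.
    have := opt _ _ (traj_feasible s x (fun j => a * v j + u j)).
    by rewrite (costE _ _ fxx) -/(cost _) costD -addrA lerDl.
  have q1 : 0 < q + 1 by rewrite ltr_wpDl.
  apply/eqP; rewrite -sqrf_eq0 eq_le sqr_ge0 andbT.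
  (* Adding 1 to [q] avoids a division by zero; at this point the polynomial equals
     [- l^2 / (q + 1)^2], which forces [l = 0]. *)
  have := H (- (l / (q + 1))).
  rewrite (_ : _ + _ = - (l ^+ 2 * ((q + 1)^-1 ^+ 2))); last first.
    by field; rewrite lt0r_neq0.
  by rewrite oppr_ge0 pmulr_lle0// exprn_gt0// invr_gt0.
exists (traj s x u); first exact: traj_feasible.
move=> xx w fxx; rewrite (costE _ _ fxx) -/(cost u).
have -> : cost w = cost (fun j => 1 * (w j - u j) + u j).
  by congr cost; apply/funext => j; rewrite mul1r subrK.
by rewrite costD st mulr0 addr0 lerDl expr1n mul1r slope_ge0.
Qed.

(** Subtracting the two stationarity conditions in the direction [u - u'] removes the prices and
    leaves a zero slope of [u - u'] along itself. *)
Lemma agent_optimal_unique u u' :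
  agent_optimal A B Q r g s x lam u -> agent_optimal A B Q r g s x lam u' ->
  forall t : 'I_T, (s <= t)%N -> u t = u' t.
Proof.
move=> /agent_optimalP ou /agent_optimalP ou' t st.
apply/eqP; rewrite -subr_eq0; apply/eqP.
pose v j := -1 * u' j + u j.
have -> : u t - u' t = v t by rewrite /v; ring.
apply: (@slope_eq0 s v) => //.
have := slope_linl s (-1) x x u' u v; rewrite scaleN1r addNr => ->.
by have := ou v; have := ou' v; lra.
Qed.

End Prices.

End AgentTrajectory.

(** * Linear spaces of random variables *)

Section LinearClosure.
Context {R : realType} {Om : Type}.
Implicit Types S : (Om -> R) -> Prop.

(** One notion covers the functions measurable for the history, the integrable ones, those
    orthogonal to the history and the centered ones, so that each fact about linear dependence is
    proved once. *)
Definition lin_closed S :=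
  S (fun=> 0) /\ forall a f g, S f -> S g -> S (fun w => a * f w + g w).

Variable S : (Om -> R) -> Prop.
Hypothesis hS : lin_closed S.

Lemma lin_closedZ a f : S f -> S (fun w => a * f w).
Proof.
move=> Sf; have [S0 /(_ a f _ Sf S0)] := hS.
by under eq_fun do rewrite addr0.
Qed.

Lemma lin_closedMr a f : S f -> S (fun w => f w * a).
Proof. by move=> /(lin_closedZ a); under eq_fun do rewrite mulrC. Qed.

Lemma lin_closedD f g : S f -> S g -> S (fun w => f w + g w).
Proof.
move=> Sf Sg; have [_ /(_ 1 f _ Sf Sg)] := hS.
by under eq_fun do rewrite mul1r.
Qed.

Lemma lin_closed_sum (I : Type) (s : seq I) (P : pred I) (f : I -> Om -> R) :
  (forall i, P i -> S (f i)) -> S (fun w => \sum_(i <- s | P i) f i w).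
Proof.
move=> Sf; elim: s => [|i s IH].
  by under eq_fun do rewrite big_nil; case: hS.
under eq_fun do rewrite big_cons; have [Pi|//] := boolP (P i).
exact: lin_closedD (Sf _ Pi) IH.
Qed.

Lemma lin_closed_mulmx m n (C : 'M[R]_(m, n)) (x : Om -> 'cV[R]_n) :
  (forall j, S (fun w => x w j 0)) -> forall i, S (fun w => (C *m x w) i 0).
Proof.
move=> Sx i; under eq_fun do rewrite mxE.
by apply: lin_closed_sum => j _; apply: (@lin_closedZ (C i j) (fun w => x w j 0)).
Qed.

Lemma lin_closed_traj dim T (A : 'M[R]_dim) (B : 'cV[R]_dim) s
    (x : Om -> 'cV[R]_dim) (u : Om -> 'I_T -> R) :
  (forall j, S (fun w => x w j 0)) ->
  (forall j : 'I_T, (s <= j)%N -> S (fun w => u w j)) ->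
  forall t j, S (fun w => traj A B s (x w) (u w) t j 0).
Proof.
move=> Sx Su; elim=> [//|t IH] j /=; case: (boolP (s <= t)%N) => // st.
under eq_fun do rewrite mxE; apply: lin_closedD; first exact: lin_closed_mulmx.
under eq_fun do rewrite mxE; apply: lin_closedMr.
case: insubP => [k _ kt|_] /=; last by case: hS.
by apply: Su; rewrite kt.
Qed.

End LinearClosure.

(** * The joint program, its plans and the price iteration *)

Section JointPlan.
Context {R : realType} {M N T : nat} {dim : 'I_M -> nat}.
Variables (A : forall i, 'M[R]_(dim i)) (B : forall i, 'cV[R]_(dim i)).
Variables (Q : forall i, 'M[R]_(dim i)) (r : 'I_M -> R) (gam : 'I_M -> 'I_N -> R).
Hypotheses (hQ : forall i, psd (Q i)) (hr : forall i, 0 < r i).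
Implicit Types (s : nat) (x y : forall i, 'cV[R]_(dim i)) (U V : 'I_M -> 'I_T -> R).

Definition joint_slope s x U V : R :=
  \sum_i slope (A i) (B i) (Q i) (r i) s (x i) (U i) (V i).

Definition balanced s U :=
  forall n (t : 'I_T), (s <= t)%N -> \sum_i gam i n * U i t = 0.

(* First-order optimality conditions of the joint deterministic problem. *)
Definition is_plan s x U :=
  balanced s U /\ forall V, balanced s V -> joint_slope s x U V = 0.

Lemma joint_slope_linl s a x y U U' V :
  joint_slope s (fun i => a *: x i + y i) (fun i j => a * U i j + U' i j) V =
  a * joint_slope s x U V + joint_slope s y U' V.
Proof.
rewrite /joint_slope mulr_sumr -big_split; apply: eq_bigr => i _ /=.
exact: slope_linl.
Qed.

Lemma joint_slope_linr s a x U V V' :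
  joint_slope s x U (fun i j => a * V i j + V' i j) =
  a * joint_slope s x U V + joint_slope s x U V'.
Proof.
rewrite /joint_slope mulr_sumr -big_split; apply: eq_bigr => i _ /=.
exact: slope_linr.
Qed.

Lemma eq_joint_slope s x U U' V V' :
  (forall i (j : 'I_T), (s <= j)%N -> U i j = U' i j) ->
  (forall i (j : 'I_T), (s <= j)%N -> V i j = V' i j) ->
  joint_slope s x U V = joint_slope s x U' V'.
Proof.
move=> UU VV; apply: eq_bigr => i _.
by apply: eq_slope => j; [exact: UU|exact: VV].
Qed.

Lemma balanced_lin s a U V :
  balanced s U -> balanced s V -> balanced s (fun i j => a * U i j + V i j).
Proof.
move=> bU bV n t st.
transitivity (a * (\sum_i gam i n * U i t) + \sum_i gam i n * V i t).
  by rewrite mulr_sumr -big_split; apply: eq_bigr => i _ /=; ring.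
by rewrite bU// bV// mulr0 addr0.
Qed.

Lemma is_plan_lin s a x y U V :
  is_plan s x U -> is_plan s y V ->
  is_plan s (fun i => a *: x i + y i) (fun i j => a * U i j + V i j).
Proof.
move=> [bU sU] [bV sV]; split=> [|Z bZ]; first exact: balanced_lin.
by rewrite joint_slope_linl sU// sV// mulr0 addr0.
Qed.

(** The difference of two plans is a balanced plan from state 0, so its slope along itself is 0.
    This is a sum of nonnegative terms over the agents, and each must vanish. *)
Lemma is_plan_unique s x U V : is_plan s x U -> is_plan s x V ->
  forall i (t : 'I_T), (s <= t)%N -> U i t = V i t.
Proof.
move=> [bU sU] [bV sV] i t st.
pose Z i j := -1 * V i j + U i j.
have bZ : balanced s Z by apply: balanced_lin.
apply/eqP; rewrite -subr_eq0 (_ : U i t - V i t = Z i t); last by rewrite /Z; ring.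
have := joint_slope_linl s (-1) x x V U Z.
rewrite sU// sV// mulr0 addr0 -/Z => sZ.
apply/eqP; apply: (slope_eq0 (hQ i) (hr i) (A := A i) (B := B i) (s := s)) => //.
have {}sZ : \sum_i slope (A i) (B i) (Q i) (r i) s 0 (Z i) (Z i) = 0.
  rewrite -[RHS]sZ; apply: eq_bigr => k _.
  by rewrite scaleN1r addNr.
rewrite -sZ (bigD1 i)//= lerDl; apply: sumr_ge0 => k _.
exact: slope_ge0 (hQ k) (hr k) _ _.
Qed.

(** Principle of optimality: a direction balanced from [s.+1] on, extended by 0 at time [s], is
    balanced from [s] on and leaves the states up to [s.+1] unchanged. *)
Lemma is_plan_tail (s : 'I_T) x U : is_plan s x U ->
  is_plan s.+1 (fun i => A i *m x i + U i s *: B i) U.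
Proof.
move=> [bU sU]; split=> [n t st|V bV]; first by rewrite bU// ltnW.
pose V' i (t : 'I_T) := if (s < t)%N then V i t else 0.
have bV' : balanced s V'.
  move=> n t _; rewrite /V'; have [st|st] := boolP (s < t)%N; first exact: bV.
  by rewrite big1// => i _; rewrite mulr0.
rewrite -[RHS](sU _ bV'); apply: eq_bigr => i _.
rewrite /slope [RHS]big_mkcond [LHS]big_mkcond/=; apply: eq_bigr => t _.
have V'0 : traj (A i) (B i) s 0 (V' i) s.+1 = 0.
  by rewrite trajS// traj_start mulmx0 add0r /V' ltnn scale0r.
case: ifPn => st; last first.
  case: ifPn => // st'.
  have -> : t = s by apply/val_inj/eqP; rewrite eqn_leq st' leqNgt st.
  by rewrite /V' ltnn mulr0 addr0 !traj_start qf0r.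
rewrite ltnW// (traj_restart _ _ (x i) _ (leqnSn s) st) trajS// traj_start.
rewrite (traj_restart _ _ 0 _ (leqnSn s) st) V'0 /V' st.
by congr (qf _ _ _ + _); apply: eq_traj => j ->.
Qed.

Let cons_mx : 'M[R]_(N, M) := \matrix_(n, i) gam i n.
(** Controls are matrices over agents and times, flattened by [mxvec]; [G] applies the coefficients
    of the constraints at all times at once. *)
Let G : 'M[R]_(M * T, N * T) := lin_mx (mulmx cons_mx).

(** The second sum is a penalty on the times before [s], which the slope ignores; it makes the form
    coercive on the whole space and vanishes against controls supported from [s] on. *)
Let form s (u v : 'rV[R]_(M * T)) : R :=
  2 * (joint_slope s (fun=> 0) (vec_mx u) (vec_mx v) +
       \sum_i \sum_(t < T | (t < s)%N) r i * (vec_mx u i t * vec_mx v i t)).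

Let H s : 'M[R]_(M * T) := \matrix_(k, l) form s (delta_mx 0 k) (delta_mx 0 l).

(** Minus the gradient at zero control, so that [u *m H s = rhs s x - lam *m G^T] expresses
    stationarity at the prices [lam]. *)
Let rhs s x : 'rV[R]_(M * T) :=
  \row_k (- 2 * joint_slope s x (fun _ _ => 0) (vec_mx (delta_mx 0 k))).

Let vec_lin a (u v : 'rV[R]_(M * T)) :
  (vec_mx (a *: u + v) : 'I_M -> 'I_T -> R) =
  (fun i j => a * vec_mx u i j + vec_mx v i j).
Proof. by apply/funext => i; apply/funext => j; rewrite linearP !mxE. Qed.

Let HE s u v : dot (u *m H s) v = form s u v.
Proof.
rewrite -bilinear_form_mx// => a {u v}u v w; rewrite /form vec_lin.
  have := joint_slope_linl s a (fun=> 0) (fun=> 0) (vec_mx u) (vec_mx v) (vec_mx w).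
  rewrite [X in joint_slope s X](_ : _ = (fun=> 0)); last first.
    by apply/functional_extensionality_dep => i; rewrite scaler0 addr0.
  move=> ->; rewrite [X in 2 * (_ + X)](_ : _ =
    a * (\sum_i \sum_(t < T | (t < s)%N) r i * (vec_mx u i t * vec_mx w i t)) +
    \sum_i \sum_(t < T | (t < s)%N) r i * (vec_mx v i t * vec_mx w i t)).
    by ring.
  rewrite mulr_sumr -big_split; apply: eq_bigr => i _ /=.
  by rewrite mulr_sumr -big_split; apply: eq_bigr => t _ /=; ring.
rewrite joint_slope_linr [X in 2 * (_ + X)](_ : _ =
  a * (\sum_i \sum_(t < T | (t < s)%N) r i * (vec_mx w i t * vec_mx u i t)) +
  \sum_i \sum_(t < T | (t < s)%N) r i * (vec_mx w i t * vec_mx v i t)).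
  by ring.
rewrite mulr_sumr -big_split; apply: eq_bigr => i _ /=.
by rewrite mulr_sumr -big_split; apply: eq_bigr => t _ /=; ring.
Qed.

Let rhsE s x v : dot (rhs s x) v = - 2 * joint_slope s x (fun _ _ => 0) (vec_mx v).
Proof.
rewrite -(linear_form_row
  (f := fun v => - 2 * joint_slope s x (fun _ _ => 0) (vec_mx v)))// => a u w.
by rewrite vec_lin joint_slope_linr; ring.
Qed.

Let H_coercive s : exists2 h, 0 < h & coercive (H s) h.
Proof.
(* A positive lower bound of all [r i], valid also when there is no agent. *)
exists (1 + \sum_i (r i)^-1)^-1.
  by rewrite invr_gt0 ltr_pwDl// sumr_ge0// => i _; rewrite invr_ge0 ltW.
set h := _^-1.
have h0 : 0 < h.
  by rewrite invr_gt0 ltr_pwDl// sumr_ge0// => i _; rewrite invr_ge0 ltW.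
have hle i : h <= 2 * r i.
  have : h <= r i.
    rewrite -[leRHS]invrK lef_pV2 ?posrE ?invr_gt0//.
      rewrite (bigD1 i)//= addrCA lerDl addr_ge0// sumr_ge0// => k _.
      by rewrite invr_ge0 ltW.
    by rewrite ltr_pwDl// sumr_ge0// => k _; rewrite invr_ge0 ltW.
  by have := hr i; lra.
move=> u; rewrite HE /form -{1 2}(vec_mxK u) dot_mxvec /joint_slope.
rewrite -big_split !mulr_sumr; apply: ler_sum => i _ /=.
set Z := vec_mx u i.
rewrite [X in h * X](bigID (fun t : 'I_T => (s <= t)%N))/= !mulrDr lerD//.
  rewrite (le_trans _ (ler_wpM2l _ (slope_ge _ _ (r i) (hQ i) s Z)))//.
  rewrite !mulr_sumr ler_sum// => t _; rewrite [leRHS]mulrA -expr2.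
  by rewrite ler_wpM2r ?sqr_ge0.
rewrite (eq_bigl (fun t : 'I_T => (t < s)%N)); last by move=> t; rewrite -ltnNge.
rewrite !mulr_sumr ler_sum// => t _; rewrite [leRHS]mulrA -expr2.
by rewrite ler_wpM2r ?sqr_ge0.
Qed.

Let GE (V : 'M[R]_(M, T)) : mxvec V *m G = mxvec (cons_mx *m V).
Proof. exact: mul_vec_lin. Qed.

Let rowP_dot n (u v : 'rV[R]_n) : (forall w, dot u w = dot v w) -> u = v.
Proof.
move=> uv; apply/eqP; rewrite -subr_eq0; apply/eqP/dot_eq0.
by rewrite dotDl uv -dotDl subrr dot0l.
Qed.

Let is_plan_of_kkt s x (u : 'rV[R]_(M * T)) lam :
  u *m G = 0 -> u *m H s = rhs s x - lam *m G^T -> is_plan s x (vec_mx u).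
Proof.
move=> uG uH; split=> [n t st|V bV].
  have : vec_mx (mxvec (vec_mx u) *m G) n t = 0 by rewrite vec_mxK uG linear0 mxE.
  rewrite GE mxvecK mxE => E; rewrite -[RHS]E.
  by apply: eq_bigr => i _; rewrite [cons_mx _ _]mxE.
(* Truncating [V] before [s] makes it balanced at all times, which removes the multiplier, and
   annihilates the penalty. *)
pose Z : 'M[R]_(M, T) := \matrix_(i, t) (if (s <= t)%N then V i t else 0).
have ZG : mxvec Z *m G = 0.
  rewrite GE (_ : _ *m Z = 0) ?linear0//; apply/matrixP => n t; rewrite !mxE.
  under eq_bigr do rewrite !mxE.
  have [st|st] := boolP (s <= t)%N; first exact: bV.
  by rewrite big1// => i _; rewrite mulr0.
have := HE s u (mxvec Z); rewrite uH dotDl -scaleN1r dotZl rhsE dot_mulmxl trmxK ZG.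
rewrite (dotC lam) dot0l mulr0 addr0 /form mxvecK.
rewrite [X in _ + X]big1 ?addr0; last first.
  by move=> i _; apply: big1 => t ts; rewrite !mxE leqNgt ts mulr0 mulr0.
have -> : joint_slope s x (vec_mx u) V = joint_slope s x (vec_mx u) Z.
  by apply: eq_joint_slope => // i j sj; rewrite mxE sj.
have -> : joint_slope s x (vec_mx u) Z =
    joint_slope s (fun=> 0) (vec_mx u) Z + joint_slope s x (fun _ _ => 0) Z.
  rewrite -[X in X + _]mul1r -joint_slope_linl; apply: eq_bigr => i _.
  by rewrite scaler0 add0r; apply: eq_slope => // j _; rewrite mul1r addr0.
by set a := joint_slope _ _ _ _; set b := joint_slope _ _ _ _; lra.
Qed.

(* The optimal plan depends linearly on the initial state; this is expressed by
   its preserving every linear space of random variables. *)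
Lemma linear_plan s : exists plan : (forall i, 'cV[R]_(dim i)) -> 'I_M -> 'I_T -> R,
  (forall x, is_plan s x (plan x)) /\
  forall (Om : Type) (S : (Om -> R) -> Prop) (x : Om -> forall i, 'cV[R]_(dim i)),
    lin_closed S -> (forall i j, S (fun w => x w i j 0)) ->
    forall i t, S (fun w => plan (x w) i t).
Proof.
have [h h0 hH] := H_coercive s.
have [K KP] := kkt_matrix G h0 hH.
exists (fun x => vec_mx (rhs s x *m K)); split=> [x|Om S x hS Sx i t].
  by have [KG [lam Klam]] := KP (rhs s x); apply: is_plan_of_kkt Klam.
(* Each entry of the plan unfolds into a fixed linear combination of entries of the uncontrolled
   trajectories from [x w]. *)
under eq_fun do rewrite mxE mxE.
apply: lin_closed_sum => // k _.
apply: (lin_closedMr hS); under eq_fun do rewrite mxE; apply: (lin_closedZ hS).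
apply: lin_closed_sum => // l _; apply: lin_closed_sum => // t' _.
under eq_fun do rewrite mul0r mul0r addr0 qfE.
apply: lin_closed_sum => // m _; apply: lin_closed_sum => // m' _.
apply: (lin_closedMr hS); apply: (lin_closedMr hS).
by apply: lin_closed_traj => // j _; case: hS.
Qed.

Lemma price_iteration_cvg (alpha : nat -> R) (s : 'I_T) x
    (lam : nat -> 'I_N -> 'I_T -> R) (u : nat -> 'I_M -> 'I_T -> R) :
  (forall k, 0 < alpha k) -> alpha k @[k --> \oo] --> (0 : R) ->
  series alpha n @[n --> \oo] --> +oo ->
  price_iteration A B Q r gam alpha s x lam u ->
  exists (lams : 'I_N -> 'I_T -> R) (us : 'I_M -> 'I_T -> R),
    is_plan s x us /\
    forall t : 'I_T, (s <= t)%N ->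
      (forall n, lam k n t @[k --> \oo] --> lams n t) /\
      (forall i, u k i t @[k --> \oo] --> us i t).
Proof.
move=> al0 al_0 al_sum it.
have [h h0 hH] := H_coercive s.
(* Prices and bids before [s] are arbitrary; setting them to 0 is consistent with the stationarity
   equation, whose penalty and right-hand side then vanish there. *)
pose lm k : 'M[R]_(N, T) := \matrix_(n, t) (if (s <= t)%N then lam k n t else 0).
pose um k : 'M[R]_(M, T) := \matrix_(i, t) (if (s <= t)%N then u k i t else 0).
have umH k : mxvec (um k) *m H s = rhs s x - mxvec (lm k) *m G^T.
  apply: rowP_dot => w; rewrite HE dotDl -scaleN1r dotZl rhsE dot_mulmxl trmxK.
  rewrite -(vec_mxK w) GE dot_mxvec; set V := vec_mx w; rewrite /form !mxvecK.
  rewrite [X in _ + X]big1 ?addr0; last first.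
    by move=> i _; apply: big1 => t ts; rewrite !mxE leqNgt ts mul0r mulr0.
  have [opt _] := it k.
  (* Summing the separate stationarity conditions of the agents recombines their price terms into
     the pairing of [lm k] with the constraints. *)
  have : \sum_i (2 * slope (A i) (B i) (Q i) (r i) s (x i) (u k i) (V i) +
      price (gam i) s (lam k) (V i)) = 0.
    by apply: big1 => i _; have /agent_optimalP := opt i; apply.
  rewrite big_split -mulr_sumr/= -/(joint_slope s x (u k) V).
  have -> : joint_slope s x (u k) V =
      joint_slope s (fun=> 0) (um k) V + joint_slope s x (fun _ _ => 0) V.
    rewrite -[X in X + _]mul1r -joint_slope_linl; apply: eq_bigr => i _.
    rewrite scaler0 add0r; apply: eq_slope => // j sj.
    by rewrite mul1r addr0 mxE sj.
  have -> : \sum_i price (gam i) s (lam k) (V i) =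
      \sum_n \sum_t lm k n t * (cons_mx *m V) n t.
    rewrite /price [LHS]exchange_big/= [RHS]exchange_big/= big_mkcond/=.
    apply: eq_bigr => t _; case: ifPn => st; last first.
      by rewrite big1// => n _; rewrite mxE (negbTE st) mul0r.
    rewrite exchange_big/=; apply: eq_bigr => n _.
    rewrite !mxE st mulr_sumr; apply: eq_bigr => i _; rewrite [cons_mx _ _]mxE; ring.
  set a := joint_slope _ _ _ _; set b := joint_slope _ _ _ _; set c := \sum_n _.
  by lra.
have lmS k : mxvec (lm k.+1) = mxvec (lm k) + alpha k *: (mxvec (um k) *m G).
  rewrite GE -linearZ -linearD/=; congr mxvec; apply/matrixP => n t.
  rewrite !mxE; case: ifPn => st; last first.
    rewrite big1 ?mulr0 ?addr0// => i _.
    by rewrite !mxE (negbTE st) mulr0.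
  have [_ ->//] := it k; congr (_ + _ * _); apply: eq_bigr => i _.
  by rewrite !mxE st.
have [ls [us [usG usH lsc usc]]] := dual_ascent h0 hH al0 al_0 al_sum umH lmS.
exists (vec_mx ls), (vec_mx us); split; first exact: is_plan_of_kkt usH.
move=> t st; split=> [n|i].
  have := lsc (mxvec_index n t); under eq_fun do rewrite mxvecE mxE st.
  by rewrite mxE.
have := usc (mxvec_index i t); under eq_fun do rewrite mxvecE mxE st.
by rewrite mxE.
Qed.

(** By convexity a stationary bid suffices. Invertibility of the joint matrix [H s] provides one:
    its right-hand side involves agent [i] only, and it is tested on directions supported on agent
    [i] and on times from [s] on. *)
Lemma agent_optimal_exists (i : 'I_M) (s : 'I_T) (x : 'cV[R]_(dim i))
    (lam : 'I_N -> 'I_T -> R) :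
  exists u, agent_optimal (A i) (B i) (Q i) (r i) (gam i) s x lam u.
Proof.
have [h h0 hH] := H_coercive s.
pose f (v : 'rV[R]_(M * T)) : R :=
  - (2 * slope (A i) (B i) (Q i) (r i) s x (fun=> 0) (vec_mx v i) +
     price (gam i) s lam (vec_mx v i)).
have flin a v w : f (a *: v + w) = a * f v + f w.
  rewrite /f vec_lin slope_linr.
  have -> : price (gam i) s lam (fun j => a * vec_mx v i j + vec_mx w i j) =
      a * price (gam i) s lam (vec_mx v i) + price (gam i) s lam (vec_mx w i).
    rewrite /price mulr_sumr -big_split; apply: eq_bigr => t _ /=.
    by rewrite mulr_sumr -big_split; apply: eq_bigr => n _ /=; ring.
  by ring.
pose b : 'rV[R]_(M * T) := \row_k f (delta_mx 0 k).
pose u := b *m invmx (H s).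
have uH : u *m H s = b by rewrite mulmxKV// (coercive_unit h0 hH).
exists (vec_mx u i); apply/agent_optimalP => // v.
pose V : 'M[R]_(M, T) := \matrix_(k, t) (if (k == i) && (s <= t)%N then v t else 0).
have Vi (t : 'I_T) : (s <= t)%N -> v t = V i t by move=> st; rewrite mxE eqxx st.
have := HE s u (mxvec V); rewrite uH -linear_form_row// /f /form mxvecK.
rewrite [X in _ = 2 * (_ + X)]big1 ?addr0; last first.
  by move=> k _; apply: big1 => t ts; rewrite !mxE (leqNgt s) ts andbF mulr0 mulr0.
rewrite /joint_slope (bigD1 i)//= [X in _ = 2 * (_ + X)]big1 ?addr0; last first.
  move=> k ki; rewrite (@eq_slope _ _ _ _ _ _ _ _ _ _ (vec_mx u k) _ (fun=> 0))//.
    by apply: big1 => t _; rewrite traj0 qf0r mulr0 addr0.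
  by move=> j _; rewrite mxE (negbTE ki).
have -> : slope (A i) (B i) (Q i) (r i) s x (vec_mx u i) v =
    slope (A i) (B i) (Q i) (r i) s x (vec_mx u i) (V i).
  by apply: eq_slope.
have -> : price (gam i) s lam v = price (gam i) s lam (V i).
  by apply: eq_bigr => t st; rewrite -Vi.
have := slope_linl (A i) (B i) (Q i) (r i) s 1 0 x (vec_mx u i) (fun=> 0) (V i).
rewrite scaler0 add0r mul1r => E.
have -> : slope (A i) (B i) (Q i) (r i) s x (vec_mx u i) (V i) =
   slope (A i) (B i) (Q i) (r i) s 0 (vec_mx u i) (V i) +
   slope (A i) (B i) (Q i) (r i) s x (fun=> 0) (V i).
  by rewrite -E; apply: eq_slope => // j _; rewrite mul1r addr0.
by set a := slope _ _ _ _ _ _ _ _; set c := slope _ _ _ _ _ _ _ _; lra.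
Qed.

End JointPlan.

(** * Costates and excess cost along a path *)

Section Costate.
Context {R : realType} {M N T : nat} {dim : 'I_M -> nat}.
Variables (A : forall i, 'M[R]_(dim i)) (B : forall i, 'cV[R]_(dim i)).
Variables (Q : forall i, 'M[R]_(dim i)) (r : 'I_M -> R) (gam : 'I_M -> 'I_N -> R).
Hypotheses (hQ : forall i, psd (Q i)) (hr : forall i, 0 < r i).
Implicit Types (s : nat) (x y : forall i, 'cV[R]_(dim i)) (U V : 'I_M -> 'I_T -> R).

Local Notation is_plan := (is_plan A B Q r gam).

(* Pairing of the multiplier of the dynamics at time [s], along the plan [U] from
   [x], with a state [y]. *)
Definition costate s x U y : R :=
  \sum_i \sum_(t < T | (s <= t)%N)
    qf (Q i) (traj (A i) (B i) s (x i) (U i) t)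
       (traj (A i) (B i) s (y i) (fun _ : 'I_T => 0) t).

Lemma eq_costate s x U V y :
  (forall i (t : 'I_T), (s <= t)%N -> U i t = V i t) ->
  costate s x U y = costate s x V y.
Proof.
move=> UV; apply: eq_bigr => i _; apply: eq_bigr => t _.
by congr qf; apply: eq_traj => j; apply: UV.
Qed.

(** Plans add up and are unique, so [Z] agrees with the sum of [U] and [V]. This separates the
    contribution of the noise to the costate. *)
Lemma costateDl s x y z U V Z : is_plan s x U -> is_plan s y V ->
  is_plan s (fun i => x i + y i) Z ->
  costate s (fun i => x i + y i) Z z = costate s x U z + costate s y V z.
Proof.
move=> pU pV pZ; have pUV := is_plan_lin 1 pU pV.
have pUV' : is_plan s (fun i => x i + y i) (fun i j => 1 * U i j + V i j).
  rewrite [X in is_plan s X](_ : _ = fun i => 1 *: x i + y i)//.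
  by apply/functional_extensionality_dep => i; rewrite scale1r.
rewrite (eq_costate _ _ (is_plan_unique hQ hr pZ pUV')) -big_split.
apply: eq_bigr => i _; rewrite -big_split; apply: eq_bigr => t _ /=.
have := traj_lin (A i) (B i) s 1 (x i) (y i) (U i) (V i) t.
by rewrite !scale1r => ->; rewrite qfDl.
Qed.

Lemma costate0r s x U : costate s x U (fun=> 0) = 0.
Proof. by rewrite /costate big1// => i _; rewrite big1// => t _; rewrite traj0 qf0r. Qed.

Lemma costate_end x U y : costate T x U y = 0.
Proof.
rewrite /costate big1// => i _; rewrite big_pred0// => t.
by rewrite leqNgt ltn_ord.
Qed.

Let sum_from (s : 'I_T) (F : 'I_T -> R) :
  \sum_(t < T | (s <= t)%N) F t = F s + \sum_(t < T | (s < t)%N) F t.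
Proof.
rewrite (bigD1 s)//=; congr (_ + _); apply: eq_bigl => t.
by rewrite ltn_neqAle andbC eq_sym.
Qed.

(** Stationarity is tested on the deviation [d] applied at time [s] alone: its control cost now is
    exchanged for its effect on the later states. By the tail property and uniqueness, [U']
    continues [U]. *)
Lemma costate_step (s : 'I_T) x y U U' (d : 'I_M -> R) :
  is_plan s x U -> is_plan s.+1 (fun i => A i *m x i + U i s *: B i) U' ->
  (forall n, \sum_i gam i n * d i = 0) ->
  \sum_i (qf (Q i) (x i) (y i) + U i s * r i * d i) =
  costate s x U y - costate s.+1 (fun i => A i *m x i + U i s *: B i) U'
                      (fun i => A i *m y i + d i *: B i).
Proof.
move=> pU pU' d0.
rewrite (eq_costate _ _ (is_plan_unique hQ hr pU' (is_plan_tail pU))).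
pose V i (t : 'I_T) := if t == s then d i else 0.
have bV : balanced gam s V.
  move=> n t _; rewrite /V; have [_|_] := eqVneq t s; first exact: d0.
  by rewrite big1// => i _; rewrite mulr0.
have [_ /(_ _ bV) sV] := pU.
transitivity (\sum_i (qf (Q i) (x i) (y i) + U i s * r i * d i) -
  joint_slope A B Q r s x U V); first by rewrite sV subr0.
rewrite /joint_slope /costate -!sumrB; apply: eq_bigr => i _.
rewrite /slope !sum_from !traj_start qf0r add0r /V eqxx.
set F := \sum_(t < T | (s < t)%N) _; set C := \sum_(t < T | (s < t)%N) _.
set C' := \sum_(t < T | (s < t)%N) _.
suff -> : C' = C + F by ring.
rewrite /C' /C /F -big_split; apply: eq_bigr => t st /=.
rewrite (traj_restart _ _ (x i) _ (leqnSn s) st) trajS// traj_start.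
rewrite (traj_restart _ _ (y i) _ (leqnSn s) st) (trajS _ _ (y i))// traj_start.
rewrite (traj_restart _ _ 0 _ (leqnSn s) st) (trajS _ _ 0)// traj_start.
rewrite eqxx mulmx0 add0r scale0r addr0.
have -> : (t == s) = false by apply/eqP => ts; rewrite ts ltnn in st.
rewrite mulr0 addr0 -qfDr; congr qf.
rewrite (@eq_traj _ _ _ _ _ _ (d i *: B i) (fun j => if j == s then d i else 0) (fun=> 0)).
  have := traj_lin (A i) (B i) s.+1 1 (A i *m y i) (d i *: B i) (fun _ : 'I_T => 0)
    (fun=> 0) t.
  rewrite !scale1r => <-.
  by apply: eq_traj => j _; rewrite mulr0 addr0.
move=> j sj; case: eqP => // js; by rewrite js ltnn in sj.
Qed.

(** Expanding the competing cost around the planned one leaves twice a cross term plus nonnegative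
    squares. By [costate_step] the cross term telescopes up to the contributions of the noise. *)
Lemma social_cost_excess (plan : nat -> (forall i, 'cV[R]_(dim i)) -> 'I_M -> 'I_T -> R)
    (x x' : forall i, nat -> 'cV[R]_(dim i)) (u u' : 'I_M -> 'I_T -> R)
    (z : forall i, 'I_T -> 'cV[R]_(dim i)) :
  (forall s v, is_plan s v (plan s v)) ->
  (forall i, x i 0%N = x' i 0%N) ->
  (forall i (t : 'I_T), x i t.+1 = A i *m x i t + u i t *: B i + z i t) ->
  (forall i (t : 'I_T), x' i t.+1 = A i *m x' i t + u' i t *: B i + z i t) ->
  (forall i (t : 'I_T), u i t = plan t (fun i => x i t) i t) ->
  (forall n t, \sum_i gam i n * u' i t = 0) ->
  \sum_(t < T) \sum_(i < M) (quad (Q i) (x i t) + u i t * r i * u i t) +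
  2 * \sum_(t < T) costate t.+1 (fun i => z i t) (plan t.+1 (fun i => z i t))
                     (fun i => x' i t.+1 - x i t.+1) <=
  \sum_(t < T) \sum_(i < M) (quad (Q i) (x' i t) + u' i t * r i * u' i t).
Proof.
move=> planP x0 xS xS' uE bu'.
pose y i t := x' i t - x i t.
pose d i t := u' i t - u i t.
(* [C] vanishes at time 0 because both paths start together, and at [T] because its sum is empty. *)
pose C (t : nat) := costate t (fun i => x i t) (plan t (fun i => x i t)) (fun i => y i t).
have C0 : C 0%N = 0.
  rewrite /C [X in costate _ _ _ X](_ : _ = fun=> 0) ?costate0r//.
  by apply/functional_extensionality_dep => i; rewrite /y x0 subrr.
have CT : C T = 0 by rewrite /C costate_end.
have yS i (t : 'I_T) : y i t.+1 = A i *m y i t + d i t *: B i.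
  rewrite /y xS xS' mulmxBr scalerBl opprD addrACA subrr addr0.
  by rewrite opprD addrACA.
have bu n t : \sum_i gam i n * u i t = 0.
  have [/(_ n t (leqnn t)) b _] := planP t (fun i => x i t).
  by rewrite -[RHS]b; apply: eq_bigr => i _; rewrite uE.
have bd n t : \sum_i gam i n * d i t = 0.
  transitivity (\sum_i gam i n * u' i t - \sum_i gam i n * u i t).
    by rewrite -sumrB; apply: eq_bigr => i _; rewrite -mulrBr.
  by rewrite bu bu' subrr.
have step (t : 'I_T) : \sum_i (qf (Q i) (x i t) (y i t) + u i t * r i * d i t) =
    C t - C t.+1 + costate t.+1 (fun i => z i t) (plan t.+1 (fun i => z i t))
                     (fun i => y i t.+1).
  (* The next state without its noise; the costate at [t.+1] splits into the part that telescopes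
     and the part due to [z]. *)
  pose xp i := A i *m x i t + u i t *: B i.
  have xpz : (fun i => x i t.+1) = (fun i => xp i + z i t).
    by apply/functional_extensionality_dep => i; rewrite xS.
  have xpE : xp = (fun i => A i *m x i t + plan t (fun i => x i t) i t *: B i).
    by apply/functional_extensionality_dep => i; rewrite /xp uE.
  have -> : C t.+1 = costate t.+1 xp (plan t.+1 xp) (fun i => y i t.+1) +
      costate t.+1 (fun i => z i t) (plan t.+1 (fun i => z i t)) (fun i => y i t.+1).
    rewrite /C xpz; apply: costateDl; try exact: planP.
  rewrite opprD addrA subrK.
  rewrite [X in costate t.+1 _ _ X](_ : _ = fun i => A i *m y i t + d i t *: B i); last first.
    by apply/functional_extensionality_dep => i; rewrite yS.
  rewrite /C xpE -costate_step//.
  by under [RHS]eq_bigr do rewrite -uE.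
have -> : \sum_(t < T) costate t.+1 (fun i => z i t) (plan t.+1 (fun i => z i t))
      (fun i => x' i t.+1 - x i t.+1) =
    \sum_(t < T) \sum_i (qf (Q i) (x i t) (y i t) + u i t * r i * d i t).
  under [RHS]eq_bigr do rewrite step.
  rewrite big_split/= -[LHS]add0r; congr (_ + _).
  rewrite -(big_mkord xpredT (fun t => C t - C t.+1)).
  rewrite (eq_bigr (fun t => - (C t.+1 - C t))) => [|t _]; last by rewrite opprB.
  by rewrite sumrN telescope_sumr// CT C0 subrr oppr0.
rewrite mulr_sumr -big_split ler_sum// => t _ /=.
rewrite mulr_sumr -big_split ler_sum// => i _ /=.
have -> : x' i t = x i t + y i t by rewrite addrC subrK.
have -> : u' i t = u i t + d i t by rewrite addrC subrK.
rewrite (quadD (x i t) (y i t) (hQ i)).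
have [_ /(_ (y i t))] := hQ i.
have : 0 <= d i t * r i * d i t by rewrite mulrAC -expr2 mulr_ge0 ?sqr_ge0// ltW.
set a := quad _ (x i t); set b := qf _ _ _; set c := quad _ _.
by move: a b c (u i t) (d i t) (r i) => a b c v e rho de0 c0; lra.
Qed.

End Costate.

(** * First moments and independence *)

Section NormalAbsMoment.
Context {R : realType}.
Local Notation mu := (@lebesgue_measure R).

(** The Radon-Nikodym derivative of the normal law equals [normal_pdf] almost everywhere, since both
    have the same integral over every measurable set. *)
Lemma ge0_integral_normal_prob (m s : R) (f : R -> \bar R) :
  measurable_fun setT f -> (forall x, 0 <= f x)%E ->
  (\int[normal_prob m s]_x f x = \int[mu]_x (f x * (normal_pdf m s x)%:E))%E.
Proof.
move=> mf f0; have dom := normal_prob_dominates m s.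
rewrite -(Radon_Nikodym_SigmaFinite.change_of_variables dom)//.
have mRN := measurable_int _ (Radon_Nikodym_SigmaFinite.f_integrable dom).
have mpdf : measurable_fun setT (fun x => (normal_pdf m s x)%:E).
  by apply/measurable_EFinP; exact: measurable_normal_pdf.
apply: ae_eq_integral => //; try exact: emeasurable_funM.
apply: ae_eqe_mul2l; apply: integral_ae_eq => //.
  exact: Radon_Nikodym_SigmaFinite.f_integrable.
by move=> E _ mE; rewrite -Radon_Nikodym_SigmaFinite.f_integral.
Qed.

(** [|x|] times the density of deviation [s] is dominated by a multiple of the density of deviation
    [2 * s], which has integral 1. *)
Lemma normal_prob_abs_moment (s : R) : s != 0 ->
  (\int[normal_prob 0 s]_x `|x|%:E < +oo)%E.
Proof.
move=> s0.
have mabs : measurable_fun setT (fun x : R => `|x|%:E).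
  by apply/measurable_EFinP; exact: normr_measurable.
rewrite ge0_integral_normal_prob//.
have s20 : 2 * s != 0 by rewrite mulf_neq0.
(* The gap [1 / (2 s^2) - 1 / (8 s^2)] between the two exponents. The constant [C] combines the
   ratio of the peaks with [|x| <= (1 + c^-1) (1 + c x^2) <= (1 + c^-1) exp (c x^2)]. *)
pose c := 3 / (8 * s ^+ 2).
have ss0 : 0 < s ^+ 2 by rewrite exprn_even_gt0.
have c0 : 0 < c by rewrite divr_gt0// mulr_gt0.
pose C := (1 + c^-1) * (normal_peak s / normal_peak (2 * s)).
have C0 : 0 <= C.
  by rewrite !mulr_ge0 ?invr_ge0 ?normal_peak_ge0// addr_ge0 ?invr_ge0 ?ltW.
have bound x : `|x| * normal_pdf 0 s x <= C * normal_pdf 0 (2 * s) x.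
  rewrite !normal_pdfE// /C -mulrA (mulrA (_ / _)) divfK ?lt0r_neq0 ?normal_peak_gt0//.
  rewrite mulrCA [leRHS]mulrCA ler_wpM2l ?normal_peak_ge0//.
  rewrite /normal_fun !subr0.
  have -> : - x ^+ 2 / (s ^+ 2 *+ 2) = - (c * x ^+ 2) + - x ^+ 2 / ((2 * s) ^+ 2 *+ 2).
    by rewrite /c -(mulr_natr (s ^+ 2)) -(mulr_natr ((2 * s) ^+ 2)); field.
  rewrite expRD mulrA ler_wpM2r ?expR_ge0//.
  rewrite expRN ler_pdivrMr ?expR_gt0//.
  rewrite (le_trans _ (ler_wpM2l _ (expR_ge1Dx _)))//; last first.
    by rewrite addr_ge0 ?invr_ge0 ?ltW.
  have -> : (1 + c^-1) * (1 + c * x ^+ 2) = (1 + x ^+ 2) + (c^-1 + c * x ^+ 2).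
    by field; exact: lt0r_neq0.
  have h : 0 <= c^-1 + c * x ^+ 2.
    by apply: addr_ge0; rewrite ?invr_ge0 ?(ltW c0)// (mulr_ge0 (ltW c0))// sqr_ge0.
  by have := sqr_ge0 (`|x| - 1); rewrite sqrrB1 real_normK ?num_real//; nra.
have mpdf t : measurable_fun setT (fun x => (normal_pdf 0 t x)%:E : \bar R).
  by apply/measurable_EFinP; exact: measurable_normal_pdf.
apply: (@le_lt_trans _ _ (\int[mu]_x (C%:E * (normal_pdf 0 (2 * s) x)%:E))%E).
  apply: ge0_le_integral => //.
  - by move=> x _; rewrite mule_ge0// lee_fin normal_pdf_ge0.
  - exact: emeasurable_funM mabs (mpdf s).
  - exact: emeasurable_funM (measurable_cst _) (mpdf (2 * s)).
  - by move=> x _; rewrite -EFinM -EFinM lee_fin.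
rewrite ge0_integralZl//.
- by rewrite integral_normal_pdf mule1 ltry.
- exact: mpdf.
- by move=> x _; rewrite lee_fin normal_pdf_ge0.
Qed.

End NormalAbsMoment.

(** * Means of symmetric functions and of independent products *)

Section Integrals.
Context {d : measure_display} {Omega : measurableType d} {R : realType}.
Variable P : probability Omega R.

Definition L1 (f : Omega -> R) : Prop := P.-integrable setT (EFin \o f).

Lemma L1_measurable f : L1 f -> measurable_fun setT f.
Proof. by move=> /measurable_int /measurable_EFinP. Qed.

Lemma L1_lin_closed : lin_closed L1.
Proof.
split; first exact: integrable0.
move=> a f g lf lg; rewrite /L1.
rewrite (_ : _ \o _ = (fun w => a%:E * (EFin \o f) w)%E \+ (EFin \o g))//.
by apply: integrableD => //; apply: integrableZl.
Qed.

(** The integral depends on the law only, hence equals its own opposite; integrability makes it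
    finite. *)
Lemma integral_symmetric (f : Omega -> R) : L1 f ->
  (forall C, measurable C -> P (f @^-1` C) = P ((fun w => - f w) @^-1` C)) ->
  (\int[P]_w (f w)%:E = 0)%E.
Proof.
move=> lf sym; have mf := L1_measurable lf.
have mNf : measurable_fun setT (fun w => - f w) by exact: measurable_funN.
have lNf : L1 (fun w => - f w).
  rewrite /L1 (_ : _ \o _ = \- (EFin \o f))%E//; exact: integrableN.
have E : (\int[P]_w (f w)%:E = \int[P]_w (- f w)%:E)%E.
  have mE : measurable_fun setT (@EFin R) by exact: EFin_measurable.
  have := integral_pushforward mf mE (D := setT) (mu := P).
  rewrite preimage_setT => <-//.
  have := integral_pushforward mNf mE (D := setT) (mu := P).
  rewrite preimage_setT => <-//.
  by apply: eq_measure_integral => C mC _; exact: sym.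
move: E; rewrite (_ : (\int[P]_w (- f w)%:E = - \int[P]_w (f w)%:E)%E); last first.
  under eq_integral do rewrite EFinN.
  by rewrite integralN// fin_num_adde_defl// fin_numN; apply: integrable_neg_fin_num.
have : (\int[P]_w (f w)%:E)%E \is a fin_num by apply: integrable_fin_num.
move: (\int[P]_w _)%E => [a| |]// _ [] aNa; congr EFin; lra.
Qed.

(** Independence identifies the joint law with the product of the two laws, to which the theorems of
    Tonelli and Fubini apply. *)
Lemma L1_mul_indep (f g : Omega -> R) : L1 f -> L1 g ->
  (forall C D, measurable C -> measurable D ->
     P (f @^-1` C `&` g @^-1` D) = (P (f @^-1` C) * P (g @^-1` D))%E) ->
  L1 (fun w => f w * g w) /\
  (\int[P]_w (f w * g w)%:E = \int[P]_w (f w)%:E * \int[P]_w (g w)%:E)%E.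
Proof.
move=> lf lg ind; have mf := L1_measurable lf; have mg := L1_measurable lg.
have mfg : measurable_fun setT (fun w => (f w, g w)) by exact: measurable_fun_pair.
pose F : {mfun Omega >-> R} := mfun_Sub (mem_set mf).
pose G : {mfun Omega >-> R} := mfun_Sub (mem_set mg).
pose FG : {mfun Omega >-> (R * R)%type} := mfun_Sub (mem_set mfg).
pose m1 := distribution P F; pose m2 := distribution P G.
pose h (z : R * R) : \bar R := (z.1 * z.2)%:E.
have mh : measurable_fun setT h.
  by apply/measurable_EFinP; apply: measurable_funM.
have mE : measurable_fun setT (@EFin R) by exact: EFin_measurable.
have mabs : measurable_fun setT (fun x : R => `|x|%:E).
  by apply/measurable_EFinP; exact: normr_measurable.
have absfin (k : {mfun Omega >-> R}) : L1 k -> 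
    exists a : R, (\int[distribution P k]_x `|x|%:E = a%:E)%E.
  move=> lk; rewrite ge0_integral_distribution//.
  have /integrableP[_] := lk.
  have : (0 <= \int[P]_x `|(EFin \o k) x|)%E by apply: integral_ge0.
  rewrite /=; case: (\int[P]_x _)%E => // a _ _; by exists a.
have [a1 a1E] := absfin F lf; have [a2 a2E] := absfin G lg.
have prodE X : measurable X -> (m1 \x m2)%E X = distribution P FG X.
  by move=> mX; apply: product_measure_unique => // C D mC mD; exact: ind.
have hint : (m1 \x m2)%E.-integrable setT h.
  apply/integrable12ltyP => //.
  rewrite (_ : (\int[m1]_x _)%E = (a1 * a2)%:E) ?ltry//.
  under eq_integral => x _.
    under eq_integral => y _ do rewrite /h /= normrM EFinM.
    rewrite ge0_integralZl// a2E muleC; over.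
  rewrite ge0_integralZl//; last first.
    by rewrite -a2E; apply: integral_ge0.
  by rewrite a1E -EFinM mulrC.
have hint' : (distribution P FG).-integrable setT h.
  apply/integrableP; split => //; have /integrableP[_] := hint.
  apply: le_lt_trans; rewrite le_eqVlt; apply/orP; left; apply/eqP.
  by apply: eq_measure_integral => X mX _; exact/esym/prodE.
have lfg : L1 (fun w => f w * g w).
  apply/integrableP; split.
    by apply/measurable_EFinP; apply: measurable_funM.
  have /integrableP[_] := hint'; rewrite ge0_integral_distribution//.
  exact: measurableT_comp.
split=> //.
have := integral_distribution (X := FG) (P := P) mh lfg => /= <-.
have -> : (\int[distribution P FG]_z h z = \int[m1 \x m2]_z h z)%E.
  by apply: eq_measure_integral => X mX _; exact/esym/prodE.
rewrite -integral12_prod_meas1//.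
have fE : (\int[m1]_x x%:E = \int[P]_w (f w)%:E)%E.
  by rewrite integral_distribution.
have gE : (\int[m2]_x x%:E = \int[P]_w (g w)%:E)%E.
  by rewrite integral_distribution.
have int1 : m1.-integrable setT EFin by exact: integrable_pushforward.
have int2 : m2.-integrable setT EFin by exact: integrable_pushforward.
transitivity (\int[m1]_x (x%:E * \int[P]_w (g w)%:E))%E.
  apply: eq_integral => x _; rewrite -gE -integralZl//.
have gfin : (\int[P]_w (g w)%:E)%E \is a fin_num by apply: integrable_fin_num.
by rewrite -(fineK gfin) integralZr// fE.
Qed.


End Integrals.

(** * Gaussian vectors and independence from the rest of a family *)

Section GaussianVectors.
Context {d : measure_display} {Omega : measurableType d} {R : realType}.
Variable P : probability Omega R.

Lemma gaussian_coord_L1 n (Y : Omega -> 'cV[R]_n) S j :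
  gaussian P Y S -> L1 P (fun w => Y w j 0).
Proof.
move=> [[_ Sge0] mY lawY].
(* [normal_prob] lives on the copy [measurableTypeR R] of [R]. *)
have mYj : @measurable_fun _ _ Omega (measurableTypeR R) setT (fun w => Y w j 0).
  exact: mY.
pose F : {mfun Omega >-> measurableTypeR R} :=
  @mfun_Sub _ _ Omega (measurableTypeR R) _ (mem_set mYj).
pose e : 'cV[R]_n := delta_mx j 0.
have mabs : measurable_fun [set: measurableTypeR R] (fun x : R => `|x|%:E).
  by apply/measurable_EFinP; exact: normr_measurable.
have law C : measurable C -> distribution P F C = centered_normal (quad S e) C.
  move=> mC; rewrite -lawY//; congr (P _); apply/seteqP; split => w /=;
    by rewrite /F /e trmx_delta -rowE mxE.
apply/integrableP; split; first exact/measurable_EFinP.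
have := ge0_integral_distribution F mabs => /(_ P (fun y => normr_ge0 y)).
rewrite /comp/= => <-.
have [v0|v0] := eqVneq (quad S e) 0.
  have -> : (\int[distribution P F]_y `|y|%:E =
      \int[@dirac _ (measurableTypeR R) (0%R : R) R]_y `|y|%:E)%E.
    apply: eq_measure_integral => C mC _; apply: etrans (law C mC) _.
    by rewrite /centered_normal v0 eqxx.
  by rewrite integral_dirac// normr0 mule0 ltry.
have -> : (\int[distribution P F]_y `|y|%:E =
    \int[normal_prob 0 (Num.sqrt (quad S e))]_y `|y|%:E)%E.
  apply: eq_measure_integral => C mC _; apply: etrans (law C mC) _.
  by rewrite /centered_normal (negbTE v0).
apply: normal_prob_abs_moment; rewrite sqrtr_eq0 -ltNge.
by rewrite lt_neqAle eq_sym v0 Sge0.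
Qed.

(** The functionals [e] and [- e] have the same variance, so the law of a coordinate is
    symmetric. *)
Lemma gaussian_coord_mean n (Y : Omega -> 'cV[R]_n) S j :
  gaussian P Y S -> (\int[P]_w (Y w j 0)%:E = 0)%E.
Proof.
move=> gY; have lY := gaussian_coord_L1 j gY.
apply: integral_symmetric lY _ => C mC.
have [_ _ lawY] := gY; pose e : 'cV[R]_n := delta_mx j 0.
have eE w : (e^T *m Y w) 0 0 = Y w j 0 by rewrite /e trmx_delta -rowE mxE.
have := lawY e C mC; under eq_fun do rewrite eE; move=> ->.
have := lawY (- e) C mC.
rewrite (_ : quad S (- e) = quad S e); last first.
  by rewrite !quad_qf -scaleN1r qfZl qfZr; ring.
by move=> <-; congr (P _); apply/seteqP; split => w /=; rewrite linearN mulNmx mxE eE.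
Qed.

Lemma sigma_vector_measurable n (Y : Omega -> 'cV[R]_n) :
  (forall j, measurable_fun setT (fun w => Y w j 0)) ->
  sigma_vector Y `<=` measurable.
Proof.
move=> mY; apply: smallest_sub; first exact: sigma_algebra_measurable.
by move=> _ [j _ [C mC <-]]; apply: mY.
Qed.

(* Independence passes from the family to the sigma-algebra generated by all of
   its members but one, since the intersections of events of these members form
   a pi-system. *)
Lemma independent_of_others (K : finType) (F : K -> set (set Omega)) (k0 : K) :
  (forall k, F k setT) -> (forall k, setI_closed (F k)) ->
  (forall k, F k `<=` measurable) -> mutually_independent P F ->
  forall E D, <<s \bigcup_(k in [set k | k != k0]) F k >> E -> F k0 D ->
    P (E `&` D) = (P E * P D)%E.
Proof.
move=> FT FI Fm ind E D FE FD.
have mD : measurable D by exact: Fm FD.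
pose G : set (set Omega) := [set C | exists2 f : K -> set Omega,
  forall k, k != k0 -> F k (f k) & C = \bigcap_(k in [set k | k != k0]) f k].
have GT : G setT by exists (fun=> setT) => //; rewrite bigcapT.
have Gm : G `<=` measurable.
  move=> _ [f fF ->]; apply: fin_bigcap_measurable => //= k kk0.
  exact/Fm/fF.
have GI : setI_closed G.
  move=> _ _ [f fF ->] [g gF ->]; exists (fun k => f k `&` g k).
    by move=> k kk0; apply: FI; [exact: fF|exact: gF].
  by rewrite bigcapI.
have sFG : <<s \bigcup_(k in [set k | k != k0]) F k >> `<=` <<s G >>.
  apply: sub_sigma_algebra2 => C [k /= kk0 FC].
  exists (fun l => if l == k then C else setT).
    by move=> l _; case: eqP => [->|].
  apply/seteqP; split => w Cw; last by have := Cw k kk0; rewrite eqxx.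
  by move=> l _ /=; case: eqP.
have PDfin : P D \is a fin_num by exact: fin_num_measure.
pose p := NngNum (fine_ge0 (measure_ge0 P D)).
have indG C : G C -> P (C `&` D) = (p%:num%:E * P C)%E.
  move=> [f fF CE]; rewrite /= fineK//.
  pose f' k := if k == k0 then D else f k.
  have f'F k : F k (f' k).
    by rewrite /f'; case: eqP => [->//|/eqP]; exact: fF.
  have := ind (finset.setTfor K) f' (fun k _ => f'F k).
  rewrite (bigD1 k0)//= [X in P X = _ -> _](_ : _ = C `&` D).
    move=> ->; rewrite {1}/f' eqxx; congr (_ * _)%E.
    (* Independence is used a second time, without [k0], to recognize the remaining product as
       [P C]. *)
    have := ind (~: [set k0]%SET)%SET f' (fun k _ => f'F k).
    rewrite [X in P X = _ -> _](_ : _ = C).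
      by move=> ->; apply: eq_bigl => k; rewrite !inE.
    rewrite CE; apply/seteqP; split => w Cw k /= kk0.
      by have := Cw k; rewrite /f' /= !inE (negbTE kk0) /=; apply.
    by move: kk0; rewrite !inE => kk0; rewrite /f' (negbTE kk0); apply: Cw.
  rewrite CE; apply/seteqP; split => [w Cw|w [Cw Dw] k _].
    split; last by have := Cw k0; rewrite /f' /= eqxx inE; apply.
    by move=> k /= kk0; have := Cw k; rewrite /f' (negbTE kk0) /= inE; apply.
  by rewrite /f'; case: eqP => // /eqP kk0; apply: Cw.
rewrite muleC -(fineK PDfin).
(* The restriction of [P] to [D] and [P] scaled by [P D] agree on the pi-system [G], hence on what
   it generates. *)
have := g_sigma_algebra_measure_unique G Gm (fun=> setT) (fun=> GT) _
  (mrestr P mD) (mscale p P) GI indG.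
apply => //.
- by rewrite bigcup_const.
- by move=> _; apply: le_lt_trans (probability_le1 P _) (ltry 1); apply: measurableI.
- exact: sFG.
Qed.

End GaussianVectors.

(** * History, noise and orthogonality *)

Section Noise.
Context {d : measure_display} {Omega : measurableType d} {R : realType}.
Variable P : probability Omega R.
Context {M T : nat} {dim : 'I_M -> nat}.
Variables (Sigma0 : forall i, 'M[R]_(dim i)) (V : forall i, 'I_T -> 'M[R]_(dim i)).
Variables (X0 : forall i, Omega -> 'cV[R]_(dim i))
          (W : forall i, 'I_T -> Omega -> 'cV[R]_(dim i)).
Hypotheses (hX0 : forall i, gaussian P (X0 i) (Sigma0 i))
  (hW : forall i t, gaussian P (W i t) (V i t))
  (hind : mutually_independent P (fun k => sigma_vector (primitive X0 W k))).

Lemma sigma_algebra_lin_closed (G : set (set Omega)) :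
  lin_closed (fun f : Omega -> R => forall C, measurable C -> <<s G >> (f @^-1` C)).
Proof.
pose mf (f : Omega -> R) := @measurable_fun _ _ (g_sigma_algebraType G) R setT f.
have mfP f : mf f <-> forall C, measurable C -> <<s G >> (f @^-1` C).
  split=> [h C mC|h _ C mC]; last by rewrite setTI; exact: h.
  by have := h measurableT C mC; rewrite setTI.
split=> [|a f g /mfP mf_f /mfP mf_g]; apply/mfP; first exact: measurable_cst.
by apply: measurable_funD => //; apply: measurable_funM => //; exact: measurable_cst.
Qed.

(* [filtration X0 W t], also defined at [t = T]. *)
Definition history (n : nat) : set (set Omega) :=
  <<s (\bigcup_(i in [set: 'I_M]) coord_events (X0 i)) `|`
      (\bigcup_(p in [set p : 'I_M * 'I_T | (p.2 < n)%N])
         coord_events (W p.1 p.2)) >>.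

Definition history_fun n (f : Omega -> R) : Prop :=
  forall C, measurable C -> history n (f @^-1` C).

Lemma history_fun_lin_closed n : lin_closed (history_fun n).
Proof. exact: sigma_algebra_lin_closed. Qed.

Lemma history_funS n f : history_fun n f -> history_fun n.+1 f.
Proof.
move=> hf C mC; apply: sub_sigma_algebra2 (hf C mC).
apply: setUS => D [p /= pn Dp]; exists p => //=.
exact: ltnW.
Qed.

Lemma history_fun_init i j : history_fun 0 (fun w => X0 i w j 0).
Proof.
move=> C mC; apply: sub_sigma_algebra; left; exists i => //; exists j => //.
by exists C => //; rewrite setTI.
Qed.

Lemma history_fun_noise i (t : 'I_T) j : history_fun t.+1 (fun w => W i t w j 0).
Proof.
move=> C mC; apply: sub_sigma_algebra; right; exists (i, t) => //=; exists j => //.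
by exists C => //; rewrite setTI.
Qed.

Let primitive_meas k j : measurable_fun setT (fun w => primitive X0 W k w j 0).
Proof.
case: k j => i [t|] j; first by have [_ h _] := hW i t; exact: (h j).
by have [_ h _] := hX0 i; exact: (h j).
Qed.

Lemma history_measurable n : history n `<=` measurable.
Proof.
apply: smallest_sub; first exact: sigma_algebra_measurable.
move=> E [[i _ [j _ [C mC <-]]]|[p _ [j _ [C mC <-]]]].
- exact: (primitive_meas (k := (i, None))).
- exact: (primitive_meas (k := (p.1, Some p.2))).
Qed.

Lemma history_fun_measurable n f : history_fun n f -> measurable_fun setT f.
Proof. by move=> hf _ C mC; rewrite setTI; exact: history_measurable (hf C mC). Qed.

(** The history at [t] only involves initial states and noises strictly before [t], all of them
    primitives other than [(i, Some t)]. *)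
Lemma noise_independent i (t : 'I_T) j f C D :
  history_fun t f -> measurable C -> measurable D ->
  P ((fun w => W i t w j 0) @^-1` C `&` f @^-1` D) =
  (P ((fun w => W i t w j 0%R) @^-1` C) * P (f @^-1` D))%E.
Proof.
move=> hf mC mD; rewrite setIC muleC.
apply: (@independent_of_others _ _ _ P _
  (fun k => sigma_vector (primitive X0 W k)) (i, Some t)) => //.
- move=> k; exact: (@measurableT _ (g_sigma_algebraType (coord_events _))).
- by move=> k A B; exact: (@measurableI _ (g_sigma_algebraType (coord_events _))).
- move=> k; apply: sigma_vector_measurable; exact: primitive_meas.
- apply: sub_sigma_algebra2 (hf D mD) => E [[l _ El]|[p /= pt Ep]].
    exists (l, None); first by apply/eqP.
    exact: (@sub_sigma_algebra _ setT (coord_events (X0 l)) _ El).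
  exists (p.1, Some p.2).
    by apply/eqP => -[_ pE]; rewrite pE ltnn in pt.
  exact: (@sub_sigma_algebra _ setT (coord_events (W p.1 p.2)) _ Ep).
- apply: sub_sigma_algebra; exists j => //; exists C => //.
  by rewrite setTI.
Qed.

(** For each fixed [g] the condition is linear in [f], so it passes from the noise to the plan
    started at the noise. Integrability of the product is included because no second moments are at
    hand. *)
Definition orthogonal_to_history n (f : Omega -> R) : Prop :=
  L1 P f /\ forall g, history_fun n g -> L1 P g ->
    L1 P (fun w => f w * g w) /\ (\int[P]_w (f w * g w)%:E = 0)%E.

Lemma noise_orthogonal i (t : 'I_T) j :
  orthogonal_to_history t (fun w => W i t w j 0).
Proof.
have lW := gaussian_coord_L1 j (hW i t); split=> // g hg lg.
have [//|lWg ->] := L1_mul_indep lW lg; last first.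
  by split=> //; rewrite (gaussian_coord_mean j (hW i t)) mul0e.
by move=> C D mC mD; apply: noise_independent.
Qed.

Lemma orthogonal_lin_closed n : lin_closed (orthogonal_to_history n).
Proof.
have [L0 LD] := L1_lin_closed P.
split=> [|a f g [lf of_] [lg og]]; split=> //.
- move=> g _ _; under eq_fun do rewrite mul0r.
  by split=> //; under eq_integral do rewrite mul0r; rewrite integral0.
- exact: LD.
move=> h hh lh; have [lfh fh0] := of_ h hh lh; have [lgh gh0] := og h hh lh.
have E : (fun w => (a * f w + g w) * h w) = (fun w => a * (f w * h w) + g w * h w).
  by apply/funext => w; ring.
split; first by rewrite E; apply: LD.
under eq_integral do rewrite mulrDl -mulrA EFinD EFinM.
by rewrite integralD//; [rewrite integralZl// fh0 gh0 mule0 add0e|exact: integrableZl].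
Qed.

(** One induction serves the feedback control, which inherits [S] from the states, and a competing
    control, which has it by assumption. *)
Lemma state_lin_closed (S : nat -> (Omega -> R) -> Prop)
    (A : forall i, 'M[R]_(dim i)) (B : forall i, 'cV[R]_(dim i))
    (U : 'I_M -> 'I_T -> Omega -> R) (X : forall i, nat -> Omega -> 'cV[R]_(dim i)) :
  (forall n, lin_closed (S n)) -> (forall n f, S n f -> S n.+1 f) ->
  (forall i j, S 0%N (fun w => X0 i w j 0)) ->
  (forall i (t : 'I_T) j, S t.+1 (fun w => W i t w j 0)) ->
  state_process A B X0 W U X ->
  (forall t : 'I_T, (forall i j, S t (fun w => X i t w j 0)) -> forall i, S t (U i t)) ->
  forall n, (n <= T)%N -> forall i j, S n (fun w => X i n w j 0).
Proof.
move=> Slin Smono S0 SW XP SU; elim=> [_|n IH nT] i j.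
  by under eq_fun do rewrite (XP i _).1.
pose t : 'I_T := Ordinal nT.
have Sn k l := IH (ltnW nT) k l.
under eq_fun do rewrite ((XP i _).2 t) mxE.
apply: (lin_closedD (Slin _)); last exact: (SW i t j).
apply: Smono; under eq_fun do rewrite mxE.
apply: (lin_closedD (Slin _)); first exact: (lin_closed_mulmx (Slin n)).
under eq_fun do rewrite mxE; apply: (lin_closedMr (Slin _)).
exact: (SU t).
Qed.

End Noise.

(** * Expected cost *)

Section ExpectedCost.
Context {d : measure_display} {Omega : measurableType d} {R : realType}.
Variable P : probability Omega R.

Lemma lin_closedI (S S' : (Omega -> R) -> Prop) :
  lin_closed S -> lin_closed S' -> lin_closed (fun f => S f /\ S' f).
Proof.
move=> [S0 SD] [S'0 S'D]; split=> // a f g [Sf S'f] [Sg S'g].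
by split; [exact: SD|exact: S'D].
Qed.

Definition centered (f : Omega -> R) : Prop :=
  L1 P f /\ (\int[P]_w (f w)%:E = 0)%E.

Lemma centered_lin_closed : lin_closed centered.
Proof.
have [L0 LD] := L1_lin_closed P.
split=> [|a f g [lf f0] [lg g0]].
  by split=> //; rewrite integral0.
split; first exact: LD.
under eq_integral do rewrite EFinD EFinM.
by rewrite integralD//; [rewrite integralZl// f0 g0 mule0 add0e|exact: integrableZl].
Qed.

Lemma measurable_social_cost M T (dim : 'I_M -> nat) (Q : forall i, 'M[R]_(dim i))
    (r : 'I_M -> R) (X : forall i, nat -> Omega -> 'cV[R]_(dim i))
    (U : 'I_M -> 'I_T -> Omega -> R) :
  (forall i (t : 'I_T) j, measurable_fun setT (fun w => X i t w j 0)) ->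
  (forall i t, measurable_fun setT (U i t)) ->
  measurable_fun setT (fun w => \sum_(t < T) \sum_(i < M)
    (quad (Q i) (X i t w) + U i t w * r i * U i t w)).
Proof.
move=> mX mU; apply: measurable_sum => t; apply: measurable_sum => i.
apply: measurable_funD; last first.
  by apply: measurable_funM => //; apply: measurable_funM.
under eq_fun do rewrite quad_qf qfE.
apply: measurable_sum => k; apply: measurable_sum => l.
by apply: measurable_funM => //; apply: measurable_funM.
Qed.

(** [|f| <= 1 + f^2], and constants are integrable for a probability. It applies to a control and
    the cost, of which [r i * f^2] is a summand up to nonnegative terms. *)
Lemma L1_of_sqr (f g : Omega -> R) (a : R) : measurable_fun setT f -> L1 P g ->
  (forall w, f w ^+ 2 <= a * g w) -> L1 P f.
Proof.
move=> mf lg fg.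
have lag : L1 P (fun w => a * g w + 1).
  have [_ LD] := L1_lin_closed P; apply: LD => //.
  exact: finite_measure_integrable_cst.
apply: le_integrable lag => //; first exact/measurable_EFinP.
move=> w _; rewrite /= lee_fin.
have f1 : `|f w| <= a * g w + 1.
  have := fg w; have := sqr_ge0 (`|f w| - 1); rewrite sqrrB1 real_normK ?num_real//.
  by have := normr_ge0 (f w); nra.
by rewrite (le_trans f1)// ler_norm.
Qed.

(** Moving [z] to the right compares the nonnegative [f] with an integrable function that has the
    mean of [g]. *)
Lemma expectation_le_centered (f g z : Omega -> R) :
  measurable_fun setT f -> (forall w, 0 <= f w) -> L1 P g -> centered z ->
  (forall w, f w + z w <= g w) -> (\int[P]_w (f w)%:E <= \int[P]_w (g w)%:E)%E.
Proof.
move=> mf f0 lg [lz z0] fzg.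
have [_ LD] := L1_lin_closed P.
have lgz : L1 P (fun w => -1 * z w + g w) by exact: LD.
have fgz w : f w <= -1 * z w + g w by have := fzg w; lra.
have -> : (\int[P]_w (g w)%:E = \int[P]_w (-1 * z w + g w)%:E)%E.
  under [RHS]eq_integral do rewrite EFinD EFinM.
  rewrite integralD//; last exact: integrableZl.
  by rewrite integralZl// z0 mule0 add0e.
apply: ge0_le_integral => //.
- by move=> w _; rewrite lee_fin.
- exact/measurable_EFinP.
- exact/measurable_EFinP/(L1_measurable lgz).
- by move=> w _; rewrite lee_fin.
Qed.

End ExpectedCost.

(** * Convergence of the iterations and optimality of the resulting control *)

Theorem theorem6 (R : realType) (d : measure_display) (Omega : measurableType d)
  (P : probability Omega R) (M N T : nat) (dim : 'I_M -> nat)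
  (A : forall i : 'I_M, 'M[R]_(dim i)) (B : forall i : 'I_M, 'cV[R]_(dim i))
  (Q : forall i : 'I_M, 'M[R]_(dim i)) (r : 'I_M -> R)
  (gam : 'I_M -> 'I_N -> R)
  (Sigma0 : forall i : 'I_M, 'M[R]_(dim i))
  (V : forall i : 'I_M, 'I_T -> 'M[R]_(dim i))
  (X0 : forall i : 'I_M, Omega -> 'cV[R]_(dim i))
  (W : forall i : 'I_M, 'I_T -> Omega -> 'cV[R]_(dim i))
  (alpha : nat -> R)
  (hQ : forall i, psd (Q i)) (hr : forall i, 0 < r i)
  (hX0 : forall i, gaussian P (X0 i) (Sigma0 i))
  (hW : forall i t, gaussian P (W i t) (V i t))
  (hind : mutually_independent P (fun k => sigma_vector (primitive X0 W k)))
  (halpha_gt0 : forall k, 0 < alpha k)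
  (halpha_0 : alpha k @[k --> \oo] --> (0 : R))
  (halpha_sum : series alpha n @[n --> \oo] --> +oo) :
  [/\ (* each agent's problem has an optimal bid sequence, and only one *)
      forall (i : 'I_M) (s : 'I_T) (xs : 'cV[R]_(dim i))
             (lam : 'I_N -> 'I_T -> R),
        let optimal :=
          agent_optimal (A i) (B i) (Q i) (r i) (gam i) s xs lam in
        (exists u, optimal u) /\
        (forall u u', optimal u -> optimal u' ->
           forall t : 'I_T, (s <= t)%N -> u t = u' t),
      (* the iteration at any time s, from any states and prices, converges *)
      forall (s : 'I_T) (xs : forall i, 'cV[R]_(dim i))
             (lam : nat -> 'I_N -> 'I_T -> R) (u : nat -> 'I_M -> 'I_T -> R),
        price_iteration A B Q r gam alpha s xs lam u ->
        exists (lams : 'I_N -> 'I_T -> R) (us : 'I_M -> 'I_T -> R),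
          forall t : 'I_T, (s <= t)%N ->
            (forall n, lam k n t @[k --> \oo] --> lams n t) /\
            (forall i, u k i t @[k --> \oo] --> us i t)
    & (* applying U_i(s) = u*_{i,s}(s) at each time s is optimal *)
      forall (X : forall i, nat -> Omega -> 'cV[R]_(dim i))
             (U : 'I_M -> 'I_T -> Omega -> R)
             (lam : Omega -> 'I_T -> nat -> 'I_N -> 'I_T -> R)
             (u : Omega -> 'I_T -> nat -> 'I_M -> 'I_T -> R),
        state_process A B X0 W U X ->
        (forall w s, price_iteration A B Q r gam alpha s (fun i => X i s w)
                       (lam w s) (u w s)) ->
        (forall w s i, u w s k i s @[k --> \oo] --> U i s w) ->
        [/\ adapted (filtration X0 W) U, constraints gam U &
            forall (X' : forall i, nat -> Omega -> 'cV[R]_(dim i))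
                   (U' : 'I_M -> 'I_T -> Omega -> R),
              state_process A B X0 W U' X' ->
              adapted (filtration X0 W) U' -> constraints gam U' ->
              (social_cost P Q r X U <= social_cost P Q r X' U')%E]].
Proof.
split=> [i s xs lam optimal|s xs lam u it|X U lam u XU it Ulim].
- split; first exact: agent_optimal_exists.
  by move=> u u' ou ou' t st; apply: agent_optimal_unique ou ou' _ st.
- have [lams [us [_ cv]]] := price_iteration_cvg hQ hr halpha_gt0 halpha_0 halpha_sum it.
  by exists lams, us.
have [plan planP] := choice (linear_plan (T := T) A B gam hQ hr).
(* The limit bids form a plan from the current state. Uniqueness of limits and of plans turns the
   applied control into linear state feedback. *)
have planE i (t : 'I_T) w : U i t w = plan t (fun k => X k t w) i t.
  have [lams [us [pus cv]]] :=
    price_iteration_cvg hQ hr halpha_gt0 halpha_0 halpha_sum (it w t).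
  rewrite -(is_plan_unique hQ hr pus ((planP t).1 _) i (leqnn t)).
  have cus := (cv t (leqnn t)).2 i.
  by rewrite -(cvg_lim (@Rhausdorff R) cus) (cvg_lim (@Rhausdorff R) (Ulim w t i)).
have UE i t : U i t = fun w => plan t (fun k => X k t w) i t.
  by apply/funext => w; rewrite planE.
have balU : constraints gam U.
  move=> n t w; have [/(_ n t (leqnn t)) b _] := (planP t).1 (fun i => X i t w).
  by rewrite -[RHS]b; apply: eq_bigr => i _; rewrite planE.
have hist_lin n := history_fun_lin_closed X0 W n.
have planS (S : nat -> (Omega -> R) -> Prop) : (forall n, lin_closed (S n)) ->
    forall t : 'I_T, (forall i j, S t (fun w => X i t w j 0)) -> forall i, S t (U i t).
  by move=> Slin t SX i; rewrite UE; apply: (planP t).2.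
have histX : forall n, (n <= T)%N -> forall i j, history_fun X0 W n (fun w => X i n w j 0).
  apply: (state_lin_closed (S := history_fun X0 W)) XU _ => //.
  - exact: history_funS.
  - exact: history_fun_init.
  - exact: history_fun_noise.
  - exact: planS.
have adaptU : adapted (filtration X0 W) U.
  move=> i t; apply: (planS (history_fun X0 W)) => // k j.
  by apply: histX; exact: ltnW.
split=> // X' U' XU' adaptU' balU'.
pose S n f := history_fun X0 W n f /\ L1 P f.
have S_lin n : lin_closed (S n) by apply: lin_closedI => //; exact: L1_lin_closed.
have SS n f : S n f -> S n.+1 f by move=> [hf lf]; split=> //; exact: history_funS.
have S0 i j : S 0%N (fun w => X0 i w j 0).
  by split; [exact: history_fun_init|exact: gaussian_coord_L1].
have SW i (t : 'I_T) j : S t.+1 (fun w => W i t w j 0).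
  by split; [exact: history_fun_noise|exact: gaussian_coord_L1].
have SX := state_lin_closed S_lin SS S0 SW XU (planS S S_lin).
have SU i (t : 'I_T) : S t (U i t) by apply: planS => // k j; apply/SX/ltnW.
have histX' : forall n, (n <= T)%N -> forall i j,
    history_fun X0 W n (fun w => X' i n w j 0).
  apply: (state_lin_closed (S := history_fun X0 W)) XU' _ => //.
  - exact: history_funS.
  - exact: history_fun_init.
  - exact: history_fun_noise.
  - by move=> t _ i; apply: adaptU'.
have meas n f : history_fun X0 W n f -> measurable_fun setT f.
  exact: (history_fun_measurable hX0 hW).
pose cost (X : forall i, nat -> Omega -> 'cV[R]_(dim i))
  (U : 'I_M -> 'I_T -> Omega -> R) w := \sum_(t < T) \sum_(i < M)
  (quad (Q i) (X i t w) + U i t w * r i * U i t w).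
have cost_ge0 X1 U1 w : 0 <= cost X1 U1 w.
  apply: sumr_ge0 => t _; apply: sumr_ge0 => i _; have [_ Qge0] := hQ i.
  by rewrite addr_ge0// mulrAC -expr2 mulr_ge0 ?sqr_ge0// ltW.
rewrite /social_cost unlock -/(cost X U) -/(cost X' U').
have mcost : measurable_fun setT (cost X U).
  apply: measurable_social_cost => [i t j|i t]; last exact: meas (SU i t).1.
  by apply: meas; apply: histX; exact: ltnW.
have mcost' : measurable_fun setT (cost X' U').
  apply: measurable_social_cost => [i t j|i t]; last exact: meas (adaptU' i t).
  by apply: meas; apply: histX'; exact: ltnW.
(* A competitor of infinite cost is trivially beaten; a finite cost makes the competing controls,
   and then its states, integrable. *)
have [->|fin'] := eqVneq (\int[P]_w (cost X' U' w)%:E)%E +oo%E; first exact: leey.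
have lcost' : L1 P (cost X' U').
  apply/integrableP; split; first exact/measurable_EFinP.
  under eq_integral do rewrite /= ger0_norm//.
  by rewrite ltey.
have SU' i (t : 'I_T) : S t (U' i t).
  split; first exact: adaptU'.
  apply: (L1_of_sqr (a := (r i)^-1) _ lcost'); first exact: meas (adaptU' i t).
  move=> w; rewrite ler_pdivlMl//.
  have term_ge0 k (l : 'I_T) : 0 <= quad (Q k) (X' k l w) + U' k l w * r k * U' k l w.
    have [_ Qge0] := hQ k.
    by rewrite addr_ge0// mulrAC -expr2 mulr_ge0 ?sqr_ge0// ltW.
  rewrite /cost (bigD1 t)//= (bigD1 i)//= -!addrA [leRHS]addrCA.
  rewrite (_ : U' i t w * r i * U' i t w = r i * U' i t w ^+ 2); last by ring.
  rewrite lerDl addr_ge0//; first by have [_ Qge0] := hQ i.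
  by rewrite addr_ge0 ?sumr_ge0// => l _; rewrite sumr_ge0.
have SX' := state_lin_closed S_lin SS S0 SW XU' (fun t _ i => SU' i t).
(* The noise at time [t] cancels in the difference of the states at [t.+1], which is therefore
   already known at time [t]. *)
have SY i (t : 'I_T) j : S t (fun w => (X' i t.+1 w - X i t.+1 w) j 0).
  rewrite (_ : (fun w => _) = fun w =>
    (-1) * ((A i *m X i t w) j 0 + U i t w * B i j 0) +
    ((A i *m X' i t w) j 0 + U' i t w * B i j 0)).
    apply: (S_lin t).2.
      apply: (lin_closedD (S_lin t)); last exact: (lin_closedMr (S_lin t)).
      by apply: (lin_closed_mulmx (S_lin t)) => k; apply/SX/ltnW.
    apply: (lin_closedD (S_lin t)); last exact: (lin_closedMr (S_lin t)).
    by apply: (lin_closed_mulmx (S_lin t)) => k; apply/SX'/ltnW.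
  by apply/funext => w; rewrite (XU i w).2 (XU' i w).2 !mxE; ring.
pose Z w := \sum_(t < T) costate A B Q t.+1 (fun i => W i t w)
  (plan t.+1 (fun i => W i t w)) (fun i => X' i t.+1 w - X i t.+1 w).
(* The pairing is a finite sum of products of two factors. The first is linear in the noise at [t],
   hence orthogonal to the history; the second is a linear function of the state gap, integrable and
   known at time [t]. *)
have Z0 : centered P (fun w => 2 * Z w).
  apply: (lin_closedZ (centered_lin_closed P)).
  apply: (lin_closed_sum (centered_lin_closed P)) => t _.
  apply: (lin_closed_sum (centered_lin_closed P)) => i _.
  apply: (lin_closed_sum (centered_lin_closed P)) => tau _.
  under eq_fun do rewrite qfE.
  apply: (lin_closed_sum (centered_lin_closed P)) => k _.
  apply: (lin_closed_sum (centered_lin_closed P)) => l _.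
  under eq_fun do rewrite mulrAC.
  apply: (lin_closedMr (centered_lin_closed P)).
  have orth := orthogonal_lin_closed P X0 W t.
  have oW m j : orthogonal_to_history P X0 W t (fun w => W m t w j 0).
    exact: (noise_orthogonal hX0 hW hind).
  have [_ oX] : orthogonal_to_history P X0 W t (fun w =>
      traj (A i) (B i) t.+1 (W i t w) (plan t.+1 (fun i => W i t w) i) tau l 0).
    apply: (lin_closed_traj orth) => // j _.
    exact: (planP t.+1).2.
  have [hY lY] : S t (fun w =>
      traj (A i) (B i) t.+1 (X' i t.+1 w - X i t.+1 w) (fun _ : 'I_T => 0) tau k 0).
    by apply: (lin_closed_traj (S_lin t)) => // j _; case: (S_lin t).
  exact: oX hY lY.
apply: (expectation_le_centered mcost (cost_ge0 X U) lcost' Z0) => w.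
apply: (social_cost_excess hQ hr (z := fun i t => W i t w)
  (x := fun i t => X i t w) (x' := fun i t => X' i t w)
  (fun s v => (planP s).1 v)) => [i|i t|i t|i t|n t].
- by rewrite (XU i w).1 (XU' i w).1.
- exact: (XU i w).2.
- exact: (XU' i w).2.
- exact: planE.
- exact: balU'.
Qed.
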